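(* There exists a universal constant $C>0$ such that the following holds. For all positive integers $m,n$, every matrix $A \in \mathbb{R}^{m \times n}$ and every $0<\varepsilon \leq 1$, there is a diagonal matrix $D \in \mathbb{R}_{\geq 0}^{m \times m}$ with at most $C\,\frac{n}{\varepsilon^2}$ nonzero entries such that $$(1-\varepsilon) \|Ax\|_2 \leq \|DAx\|_2 \leq (1+\varepsilon)\|Ax\|_2 \quad \text{for all } x \in \mathbb{R}^n.$$ Moreover, the weights (the diagonal entries of $D$) can be computed in polynomial time.
   Context: $\|\cdot\|_2$ denotes the Euclidean norm. *)

(* Defs.v *)
From HB Require Import structures.
From mathcomp Require Import all_boot all_order all_algebra.
From mathcomp Require Import reals.

Set Implicit Arguments.
Unset Strict Implicit.
Unset Printing Implicit Defensive.
Import Order.TTheory GRing.Theory Num.Theory.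
Local Open Scope ring_scope.

(* The norm that MathComp-Analysis puts on matrices is the sup norm, hence    *)
(* this definition.                                                           *)
Definition norm2 (R : realType) (n : nat) (x : 'cV[R]_n) : R :=
  Num.sqrt (\sum_i x i 0 ^+ 2).

Definition nb_nonzero (R : realType) (m n : nat) (M : 'M[R]_(m, n)) : nat :=
  #|[set ij : 'I_m * 'I_n | M ij.1 ij.2 != 0]|.

(* Computation on real inputs is modelled by a real RAM in the style of Blum, *)
(* Shub and Smale: exact field operations and comparisons on real numbers at  *)
(* unit cost, with neither square roots nor rounding to integers.             *)
(* A machine has index registers holding natural numbers, used for control    *)
(* and addressing, and real cells addressed by an array name and two indices. *)
(* Numbers cannot be moved from real cells to index registers. The syntax of  *)
(* programs does not mention R, so the only constants are natural numbers.    *)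

Inductive iexp : Type :=
  | ICst of nat
  | IReg of nat
  | IAdd of iexp & iexp
  | ISub of iexp & iexp.

Inductive rexp : Type :=
  | RCst of nat
  | RCell of nat & iexp & iexp
  | RAdd of rexp & rexp
  | ROpp of rexp
  | RMul of rexp & rexp
  | RInv of rexp.

Inductive test : Type :=
  | TLeI of iexp & iexp
  | TLeR of rexp & rexp
  | TNot of test
  | TAnd of test & test.

Inductive cmd : Type :=
  | Skip
  | SetI of nat & iexp
  | SetR of nat & iexp & iexp & rexp
  | Seq of cmd & cmd
  | If of test & cmd & cmd
  | While of test & cmd.

Record state (R : realType) : Type := State {
  ireg : nat -> nat;
  cell : nat -> nat -> nat -> R
}.

Section Semantics.
Variable R : realType.
Implicit Types s : state R.

Fixpoint ieval s (e : iexp) : nat :=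
  match e with
  | ICst k => k
  | IReg x => ireg s x
  | IAdd e1 e2 => (ieval s e1 + ieval s e2)%N
  | ISub e1 e2 => (ieval s e1 - ieval s e2)%N
  end.

Fixpoint reval s (e : rexp) : R :=
  match e with
  | RCst k => k%:R
  | RCell a i j => cell s a (ieval s i) (ieval s j)
  | RAdd e1 e2 => reval s e1 + reval s e2
  | ROpp e1 => - reval s e1
  | RMul e1 e2 => reval s e1 * reval s e2
  | RInv e1 => (reval s e1)^-1
  end.

Fixpoint teval s (b : test) : bool :=
  match b with
  | TLeI e1 e2 => (ieval s e1 <= ieval s e2)%N
  | TLeR e1 e2 => reval s e1 <= reval s e2
  | TNot b1 => ~~ teval s b1
  | TAnd b1 b2 => teval s b1 && teval s b2
  end.

Definition set_ireg s (x v : nat) : state R :=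
  State (fun y => if y == x then v else ireg s y) (cell s).

Definition set_cell s (a i j : nat) (v : R) : state R :=
  State (ireg s)
    (fun a' i' j' =>
       if [&& a' == a, i' == i & j' == j] then v else cell s a' i' j').

(* exec c s t s': started in s, the program c halts in state s' after t       *)
(* steps. Every assignment and every evaluation of a test is one step; the    *)
(* expressions are part of the program text, so a step stands for a number of *)
(* elementary operations bounded by a constant of the program.                *)
Inductive exec : cmd -> state R -> nat -> state R -> Prop :=
  | ExecSkip s : exec Skip s 1 s
  | ExecSetI s x e : exec (SetI x e) s 1 (set_ireg s x (ieval s e))
  | ExecSetR s a i j e :
      exec (SetR a i j e) s 1
        (set_cell s a (ieval s i) (ieval s j) (reval s e))
  | ExecSeq s s1 s2 c1 c2 t1 t2 :
      exec c1 s t1 s1 -> exec c2 s1 t2 s2 -> exec (Seq c1 c2) s (t1 + t2) s2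
  | ExecIfT s s' b c1 c2 t :
      teval s b -> exec c1 s t s' -> exec (If b c1 c2) s t.+1 s'
  | ExecIfF s s' b c1 c2 t :
      ~~ teval s b -> exec c2 s t s' -> exec (If b c1 c2) s t.+1 s'
  | ExecWhileF s b c : ~~ teval s b -> exec (While b c) s 1 s
  | ExecWhileT s s1 s2 b c t1 t2 :
      teval s b -> exec c s t1 s1 -> exec (While b c) s1 t2 s2 ->
      exec (While b c) s (t1 + t2).+1 s2.

End Semantics.

(* Initially m and n are in index registers 0 and 1, the matrix is in array   *)
(* 0, eps is in cell (0, 0) of array 1, and everything else is zero.          *)
Definition init_state (R : realType) (m n : nat) (A : 'M[R]_(m, n)) (eps : R) :
    state R :=
  State
    (fun x => match x with 0 => m | 1 => n | _ => 0 end)%N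
    (fun a i j =>
       match a with
       | 0%N => if insub i is Some i' then
                  if insub j is Some j' then A i' j' else 0
                else 0
       | 1%N => if (i == 0%N) && (j == 0%N) then eps else 0
       | _ => 0
       end).

(* The output is read in column 0 of array 2.                                 *)
Definition computes_diag (R : realType) (P : cmd) (m n : nat)
    (A : 'M[R]_(m, n)) (eps : R) (D : 'M[R]_m) (T : nat) : Prop :=
  exists (t : nat) (s : state R),
    [/\ exec P (init_state A eps) t s,
        (t <= T)%N
      & forall i : 'I_m, cell s 2 i 0 = D i i].

(* Main.v *)
Require Import Defs.
From mathcomp Require Import all_boot all_order all_algebra.
From mathcomp Require Import boolp reals ring lra zify.
Import Order.TTheory GRing.Theory Num.Theory.
Local Open Scope ring_scope.
Set Implicit Arguments.
Unset Strict Implicit.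
Unset Printing Implicit Defensive.

(* This is the two-barrier argument of Batson, Spielman and Srivastava, in a  *)
(* form that needs only field operations. Instead of whitening the rows a_i,  *)
(* it works with their Gram matrix M: for B = sum_i w_i a_i a_i^T one keeps l *)
(* M < B < u M together with the potentials Tr M (u M - B)^-1 and Tr M (B - l *)
(* M)^-1 at most e = eps/4. Starting from u = n/e = - l, every step moves u   *)
(* by 1 + 4 e and l by 1 and increases one weight; averaging over the rows    *)
(* shows that some row and some weight keep both potentials at most e. Once   *)
(* the number t of steps reaches n/e^2, B/t approximates M. The inverses      *)
(* evolve by rank-one updates, so the Sherman-Morrison formula is the only    *)
(* matrix operation of the algorithm. If n/e^2 exceeds m, then D = I will do; *)
(* hence m steps always suffice and the running time does not depend on eps.  *)
(*                                                                            *)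
(* If A does not have full column rank, unit vectors that complete its row    *)
(* space are added as rows: any x can be moved, without changing A x, to a    *)
(* vector orthogonal to them, so they can be dropped in the end.              *)
(*                                                                            *)
(* The machine has no square roots; the entries of D are Newton               *)
(* approximations to the square roots of w_i/t, started from 2N/r_i, where N  *)
(* = m + n and r_i = sum_j |a_j^T M^-1 a_i| is within a factor sqrt N of the  *)
(* square root of the leverage score of a_i. After k iterations row i         *)
(* contributes an error of at most 4 N^2 4^-k M, whatever the magnitude of    *)
(* w_i.                                                                       *)

(** * Sherman-Morrison updates and the barrier step *)

(** Write M for [gram a]. The heart is [exists_admissible]. Once the barriers have moved, with new
    inverses Y and W, row i may receive the weight 1/c_i at the upper barrier, where c_i is
    [inv_weight]. That weight repairs the lower potential if (Tr M W - e) (c_i + a_i^T W a_i) <= (W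
    a_i)^T M (W a_i). When Tr M W > e, the left sides sum to at most (Tr M W - e) (1 - e + Tr M W)
    by [sum_inv_weight], and the right sides to at least that by [gtr_shift_down]; so some row
    complies. The trace estimates come from resolvent identities and Cauchy-Schwarz, without
    eigenvalues.

    After t steps, (t - n/e) M < B < (t (1 + 4e) + n/e) M. If n <= t e^2, this puts B/t between (1 -
    e) M and (1 + 5e) M ([sparsifier_lower], [sparsifier_upper]), and [roundedP] spends one more e
    on the square roots.

    The program is written in a loop language with a functional semantics [den]; [exec_compile]
    turns it into a machine run of polynomial length. [prepareP] reduces to a definite M,
    [bss_stepP] shows that a step keeps the invariant [bss], and [sparsifyP] collects the bounds. *)

Section Forms.
Variables (R : realFieldType) (n : nat).
Implicit Types (x y v : 'cV[R]_n) (S X Y : 'M[R]_n) (c : R).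

Definition dot x y : R := \sum_i x i 0 * y i 0.

Lemma dotE x y : dot x y = (x^T *m y) 0 0.
Proof. by rewrite mxE; apply: eq_bigr => i _; rewrite mxE. Qed.

Lemma dotC x y : dot x y = dot y x.
Proof. by apply: eq_bigr => i _; rewrite mulrC. Qed.

Lemma dotDr x y v : dot x (y + v) = dot x y + dot x v.
Proof. by rewrite !dotE mulmxDr mxE. Qed.

Lemma dotZr c x y : dot x (c *: y) = c * dot x y.
Proof. by rewrite !dotE -scalemxAr mxE. Qed.

Lemma dotNr x y : dot x (- y) = - dot x y.
Proof. by rewrite -scaleN1r dotZr mulN1r. Qed.

Lemma dotBr x y v : dot x (y - v) = dot x y - dot x v.
Proof. by rewrite dotDr dotNr. Qed.

Lemma dot0r x : dot x 0 = 0.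
Proof. by rewrite -(scale0r 0) dotZr mul0r. Qed.

Lemma dot_sumr (I : Type) (r : seq I) (P : pred I) x (F : I -> 'cV[R]_n) :
  dot x (\sum_(i <- r | P i) F i) = \sum_(i <- r | P i) dot x (F i).
Proof. by rewrite (big_morph _ (dotDr x) (dot0r x)). Qed.

Lemma dotDl x y v : dot (x + y) v = dot x v + dot y v.
Proof. by rewrite dotC dotDr !(dotC v). Qed.

Lemma dotZl c x y : dot (c *: x) y = c * dot x y.
Proof. by rewrite dotC dotZr dotC. Qed.

Lemma dot0l x : dot 0 x = 0.
Proof. by rewrite dotC dot0r. Qed.

Lemma dot_mulmx S x y : dot x (S *m y) = dot (S^T *m x) y.
Proof. by rewrite !dotE trmx_mul trmxK mulmxA. Qed.

Lemma dot_sym S x y : S^T = S -> dot x (S *m y) = dot (S *m x) y.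
Proof. by rewrite dot_mulmx => ->. Qed.

Lemma mul_outer v y : (v *m v^T) *m y = dot v y *: v.
Proof.
apply/matrixP => i j; rewrite (ord1 j) -mulmxA mxE big_ord1 -dotE.
by rewrite mxE mulrC.
Qed.

Lemma dot_delta k x : dot (delta_mx k 0) x = x k 0.
Proof.
rewrite /dot (bigD1 k) //= mxE !eqxx mul1r big1 ?addr0 // => i /negbTE ik.
by rewrite mxE ik mul0r.
Qed.

Definition qf S x : R := dot x (S *m x).

Lemma qfD S T x : qf (S + T) x = qf S x + qf T x.
Proof. by rewrite /qf mulmxDl dotDr. Qed.

Lemma qfN S x : qf (- S) x = - qf S x.
Proof. by rewrite /qf mulNmx dotNr. Qed.

Lemma qfB S T x : qf (S - T) x = qf S x - qf T x.
Proof. by rewrite qfD qfN. Qed.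

Lemma qfZ c S x : qf (c *: S) x = c * qf S x.
Proof. by rewrite /qf -scalemxAl dotZr. Qed.

Lemma qf_outer v x : qf (v *m v^T) x = dot v x ^+ 2.
Proof. by rewrite /qf mul_outer dotZr dotC -expr2. Qed.

Lemma qf0 S : qf S 0 = 0.
Proof. exact: dot0l. Qed.

Definition posdef S := S^T = S /\ forall x, x != 0 -> 0 < qf S x.

Lemma posdef_ge0 S x : posdef S -> 0 <= qf S x.
Proof.
move=> [_ pS]; have [->|x0] := eqVneq x 0; first by rewrite qf0.
by rewrite ltW ?pS.
Qed.

Lemma posdef1 : posdef 1%:M.
Proof.
split=> [|x x0]; first exact: trmx1.
rewrite /qf mul1mx /dot lt_neqAle sumr_ge0 ?andbT => [|i _]; last first.
  by rewrite -expr2 sqr_ge0.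
apply: contraNneq x0 => h; apply/eqP/matrixP => i j; rewrite (ord1 j) mxE.
have /eqP := h; rewrite eq_sym psumr_eq0 => [/allP/(_ i (mem_index_enum _))|k _].
  by rewrite /= mulf_eq0 orbb => /eqP.
by rewrite -expr2 sqr_ge0.
Qed.

Lemma posdefZ c S : 0 < c -> posdef S -> posdef (c *: S).
Proof.
move=> c0 [symS pS]; split=> [|x x0]; first by rewrite linearZ /= symS.
by rewrite qfZ mulr_gt0 ?pS.
Qed.

Lemma qfDx S x y : S^T = S ->
  qf S (x + y) = qf S x + 2 * dot x (S *m y) + qf S y.
Proof.
move=> symS; rewrite /qf mulmxDr !dotDr !dotDl.
rewrite (dot_sym y x symS) (dotC (S *m y)); ring.
Qed.

Lemma qfZx S c x : qf S (c *: x) = c ^+ 2 * qf S x.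
Proof. by rewrite /qf -scalemxAr dotZr dotZl mulrA expr2. Qed.

(** The machine stores only [X]; the matrix [S] that it inverts lives in the invariants. *)
Definition pdinv S X := posdef S /\ S *m X = 1%:M.

Lemma pdinv_mulVmx S X : pdinv S X -> X *m S = 1%:M.
Proof. by case=> _ /mulmx1C. Qed.

Lemma pdinv_sym S X : pdinv S X -> X^T = X.
Proof.
move=> h; have [[symS _] SX] := h.
have XS : X^T *m S = 1%:M by rewrite -[in LHS]symS -trmx_mul SX trmx1.
by rewrite -[LHS]mulmx1 -SX mulmxA XS mul1mx.
Qed.

Lemma qf_inv S X x : pdinv S X -> qf X x = qf S (X *m x).
Proof.
move=> h; have [_ SX] := h.
by rewrite /qf !mulmxA SX mul1mx dotC.
Qed.

Lemma pdinv_posdef S X : pdinv S X -> posdef X.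
Proof.
move=> h; split=> [|x x0]; first exact: pdinv_sym h.
rewrite (qf_inv _ h); have [[_ pS] SX] := h; apply: pS.
by apply: contraNneq x0 => x0; rewrite -[x]mul1mx -SX -mulmxA x0 mulmx0.
Qed.

(** Cauchy-Schwarz for the inner product defined by [S], applied to [x] and [X y]. *)
Lemma cauchy_pdinv S X x y : pdinv S X -> dot y x ^+ 2 <= qf S x * qf X y.
Proof.
move=> h; have [pS SX] := h; have [symS _] := pS.
have [->|y0] := eqVneq y 0; first by rewrite qf0 dot0l expr0n mulr0.
have q0 : 0 < qf X y by apply: (pdinv_posdef h).2.
have := posdef_ge0 (qf X y *: x + (- dot y x) *: (X *m y)) pS.
rewrite qfDx // !qfZx -(qf_inv _ h) dotZl -scalemxAr dotZr !mulmxA SX mul1mx.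
rewrite (dotC x) sqrrN => ge0.
have {}ge0 : 0 <= qf X y * (qf S x * qf X y - dot y x ^+ 2).
  move: ge0; congr (0 <= _); ring.
by rewrite pmulr_rge0 // subr_ge0 in ge0.
Qed.

Definition rank1_update X c v : 'M[R]_n :=
  X - (c / (1 + c * qf X v)) *: ((X *m v) *m (X *m v)^T).

(** For [c < 0] definiteness survives because, by [cauchy_pdinv], the new form at [x] is at least
    [qf S x] times the denominator. *)
Lemma sherman_morrison S X c v : pdinv S X -> 0 < 1 + c * qf X v ->
  pdinv (S + c *: (v *m v^T)) (rank1_update X c v).
Proof.
move=> h d0; have [[symS pS] SX] := h; have symX := pdinv_sym h.
split; first split.
- by rewrite linearD linearZ /= trmx_mul trmxK symS.
- move=> x x0; rewrite qfD qfZ qf_outer.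
  have [c0|c0] := lerP 0 c.
    by rewrite ltr_wpDr ?pS // mulr_ge0 ?sqr_ge0.
  have le : c * (qf S x * qf X v) <= c * dot v x ^+ 2.
    by rewrite ler_nM2l // cauchy_pdinv.
  apply: (@lt_le_trans _ _ (qf S x * (1 + c * qf X v))).
    by rewrite mulr_gt0 ?pS.
  by rewrite mulrDr mulr1 lerD2l mulrCA.
rewrite /rank1_update.
set d := 1 + _ in d0 *; set W := v *m (X *m v)^T.
have vvX : (v *m v^T) *m X = W by rewrite /W trmx_mul symX mulmxA.
have SXv : S *m ((X *m v) *m (X *m v)^T) = W.
  by rewrite /W !mulmxA SX mul1mx.
have vvXv : (v *m v^T) *m ((X *m v) *m (X *m v)^T) = qf X v *: W.
  by rewrite mulmxA mul_outer -scalemxAl.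
rewrite mulmxBr mulmxDl SX -scalemxAr mulmxDl -!scalemxAl vvX SXv vvXv.
rewrite scalerDr !scalerA opprD addrACA -addrA -[RHS]addr0; congr (_ + _).
rewrite -!scaleNr -!scalerDl.
have d1 : d != 0 by rewrite gt_eqF.
rewrite -mulrA; have -> : c * qf X v = d - 1 by rewrite /d addrC addKr.
by rewrite [X in X *: _](_ : _ = 0) ?scale0r //; field.
Qed.

(** The updated form at [X v] equals q (1 + c q) with q = [qf X v]. This supplies the hypothesis of
    [sherman_morrison] when definiteness is known beforehand. *)
Lemma rank1_denom_gt0 S X c v : pdinv S X -> posdef (S + c *: (v *m v^T)) ->
  0 < 1 + c * qf X v.
Proof.
move=> h [_ pS']; have [->|v0] := eqVneq v 0; first by rewrite qf0 mulr0 addr0.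
have q0 : 0 < qf X v by apply: (pdinv_posdef h).2.
have Xv0 : X *m v != 0.
  by apply: contraTneq q0 => Xv0; rewrite /qf Xv0 dot0r ltxx.
have := pS' _ Xv0; rewrite qfD qfZ qf_outer -(qf_inv _ h) -/(qf X v).
have -> : qf X v + c * qf X v ^+ 2 = qf X v * (1 + c * qf X v) by ring.
by rewrite pmulr_rgt0.
Qed.

Lemma posdefD S T : posdef S -> T^T = T -> (forall x, 0 <= qf T x) ->
  posdef (S + T).
Proof.
move=> [symS pS] symT pT; split=> [|x x0]; first by rewrite linearD /= symS symT.
by rewrite qfD ltr_wpDr ?pS.
Qed.

Lemma qf_rank1_update X c v x : X^T = X ->
  qf (rank1_update X c v) x =
    qf X x - c / (1 + c * qf X v) * dot x (X *m v) ^+ 2.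
Proof.
by move=> symX; rewrite qfB qfZ qf_outer [dot (X *m v) _]dotC.
Qed.

(** * Gram matrices and the effect of barrier shifts on the potentials *)

Section Gram.
Variables (I : finType) (a : I -> 'cV[R]_n).
Implicit Type w : I -> R.

Definition wgram w : 'M[R]_n := \sum_i w i *: (a i *m (a i)^T).
Definition gram : 'M[R]_n := wgram (fun=> 1).

(* The trace of [gram *m X]. *)
Definition gtr X : R := \sum_i qf X (a i).

Lemma wgram_sym w : (wgram w)^T = wgram w.
Proof.
rewrite /wgram linear_sum; apply: eq_bigr => i _.
by rewrite linearZ /= trmx_mul trmxK.
Qed.

Lemma wgram_mul w x : wgram w *m x = \sum_i (w i * dot (a i) x) *: a i.
Proof.
rewrite /wgram mulmx_suml; apply: eq_bigr => i _.
by rewrite -scalemxAl mul_outer scalerA.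
Qed.

Lemma qf_wgram w x : qf (wgram w) x = \sum_i w i * dot (a i) x ^+ 2.
Proof.
rewrite /qf wgram_mul dot_sumr; apply: eq_bigr => i _.
by rewrite dotZr (dotC x) -mulrA.
Qed.

Lemma qf_gram x : qf gram x = \sum_i dot (a i) x ^+ 2.
Proof. by rewrite qf_wgram; apply: eq_bigr => i _; rewrite mul1r. Qed.

Lemma qf_gram_ge0 x : 0 <= qf gram x.
Proof. by rewrite qf_gram sumr_ge0 // => i _; rewrite sqr_ge0. Qed.

Lemma gram_sym : gram^T = gram. Proof. exact: wgram_sym. Qed.

Lemma gtr_ge0 X : posdef X -> 0 <= gtr X.
Proof. by move=> pX; apply: sumr_ge0 => i _; apply: posdef_ge0. Qed.

(** Cauchy-Schwarz row by row. A potential below 1 thus keeps M strictly below [S], which is why the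
    lower barrier can move by 1. *)
Lemma qf_gram_le S X x : pdinv S X -> qf gram x <= gtr X * qf S x.
Proof.
move=> h; rewrite qf_gram /gtr mulr_suml; apply: ler_sum => i _.
by rewrite mulrC; apply: cauchy_pdinv h.
Qed.

Lemma gtr_rank1_update X c v : X^T = X ->
  gtr (rank1_update X c v) = gtr X - c / (1 + c * qf X v) * qf gram (X *m v).
Proof.
move=> symX; rewrite qf_gram mulr_sumr /gtr -sumrB.
by apply: eq_bigr => i _; rewrite qf_rank1_update.
Qed.

(* Pointwise, [X - Y = d (Y M Y) + d^2 (Y M X M Y)] for [Y^-1 = X^-1 + d M]. *)
Lemma gtr_shift_up S X Y (d : R) : pdinv S X -> pdinv (S + d *: gram) Y ->
  0 <= d -> gtr Y + d * \sum_i qf gram (Y *m a i) <= gtr X.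
Proof.
move=> hX hY d0; rewrite /gtr mulr_sumr -big_split; apply: ler_sum => i _ /=.
have symX := pdinv_sym hX; have symY := pdinv_sym hY.
have XS := pdinv_mulVmx hX; have YS := pdinv_mulVmx hY.
have SX := hX.2; have SY := hY.2.
have E1 : X = Y + d *: (X *m gram *m Y).
  rewrite -[LHS]mulmx1 -SY mulmxDl mulmxDr !mulmxA XS mul1mx.
  by rewrite -scalemxAr -scalemxAl.
have E2 : X = Y + d *: (Y *m gram *m X).
  rewrite -[LHS]mul1mx -YS mulmxDr mulmxDl -!mulmxA SX mulmx1 !mulmxA.
  by rewrite -scalemxAr -scalemxAl.
set y := Y *m a i.
have -> : qf X (a i) = qf Y (a i) + d * qf gram y + d ^+ 2 * qf X (gram *m y).
  rewrite {1}/qf [in LHS]E1 mulmxDl dotDr -addrA; congr (_ + _).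
  rewrite -scalemxAl dotZr -!mulmxA -/y [in LHS]E2 mulmxDl dotDr mulrDr.
  congr (_ + _); first by rewrite (dot_sym _ _ symY).
  rewrite -scalemxAl dotZr mulrA -expr2 -!mulmxA (dot_sym _ _ symY).
  by rewrite (dot_sym _ _ gram_sym).
by rewrite lerDl mulr_ge0 ?sqr_ge0 ?posdef_ge0 //; apply: pdinv_posdef hX.
Qed.

(** Let p be the growth of the potential and b_i = M Y a_i. The resolvent identity Y = X + X M Y
    gives p = sum of b_i^T X a_i and turns the right side into p + sum of b_i^T X b_i;
    Cauchy-Schwarz bounds p^2 by the last sum. *)
Lemma gtr_shift_down S X Y : pdinv S X -> pdinv (S - gram) Y -> gtr X <= 1 ->
  (gtr Y - gtr X) * (1 + (gtr Y - gtr X)) <= \sum_i qf gram (Y *m a i).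
Proof.
move=> hX hY tX.
have symX := pdinv_sym hX; have XS := pdinv_mulVmx hX; have SY := hY.2.
have E1 : Y = X + X *m gram *m Y.
  apply/eqP; rewrite addrC -subr_eq; apply/eqP.
  rewrite -[X in _ - X]mulmx1 -SY mulmxBl mulmxBr !mulmxA XS mul1mx.
  by rewrite opprB addrC subrK.
pose b i := gram *m (Y *m a i); pose p := gtr Y - gtr X.
have pE : p = \sum_i dot (b i) (X *m a i).
  rewrite /p /gtr -sumrB; apply: eq_bigr => i _.
  rewrite {1}/qf [in LHS]E1 mulmxDl dotDr addrAC -/(qf X (a i)) subrr add0r.
  by rewrite -!mulmxA (dot_sym _ _ symX) dotC.
have cE : \sum_i qf gram (Y *m a i) = p + \sum_i qf X (b i).
  rewrite pE -big_split; apply: eq_bigr => i _ /=.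
  rewrite {1}/qf -/(b i) dotC [in LHS]E1 mulmxDl dotDr; congr (_ + _).
  by rewrite -!mulmxA.
rewrite cE -/p mulrDr mulr1 lerD2l -expr2.
(* Cauchy-Schwarz: p^2 <= gtr X * sum_i qf X (b i), where gtr X <= 1. *)
have : 0 <= \sum_i qf X (b i + (- p) *: a i).
  by apply: sumr_ge0 => i _; apply/posdef_ge0/(pdinv_posdef hX).
have -> : \sum_i qf X (b i + (- p) *: a i) =
    \sum_i qf X (b i) - 2 * p * p + p ^+ 2 * gtr X.
  rewrite {3}pE /gtr !mulr_sumr -sumrN -!big_split; apply: eq_bigr => i _ /=.
  rewrite qfDx // qfZx -scalemxAr dotZr; ring.
have : p ^+ 2 * gtr X <= p ^+ 2 * 1 by rewrite ler_wpM2l ?sqr_ge0.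
by rewrite mulr1 expr2; lra.
Qed.

Lemma posdef_shift_down S X : pdinv S X -> gtr X < 1 -> posdef (S - gram).
Proof.
move=> h tX; have [[symS pS] _] := h; split=> [|x x0].
  by rewrite linearB /= symS gram_sym.
rewrite qfB subr_gt0; apply: le_lt_trans (qf_gram_le x h) _.
by rewrite gtr_pMl ?pS.
Qed.

Lemma pdinv_mulmx_neq0 S X x : pdinv S X -> x != 0 -> X *m x != 0.
Proof.
move=> h; apply: contraNneq => Xx0.
by rewrite -[x]mul1mx -h.2 -mulmxA Xx0 mulmx0.
Qed.

(** * Existence of a row and a weight that keep both potentials *)

Section Barriers.
Variables (e : R) (U X : 'M[R]_n) (L Z : 'M[R]_n) (Y W : 'M[R]_n).
Hypotheses (e0 : 0 < e) (e1 : e <= 4^-1) (pM : posdef gram) (n0 : (0 < n)%N).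
Hypotheses (hX : pdinv U X) (tX : gtr X <= e).
Hypotheses (hZ : pdinv L Z) (tZ : gtr Z <= e).
Hypotheses (hY : pdinv (U + (1 + 4 * e) *: gram) Y).
Hypotheses (hW : pdinv (L - gram) W).

(* The inverse of the largest weight keeping the upper potential below [e]. *)
Definition inv_weight i := qf gram (Y *m a i) / (e - gtr Y) + qf Y (a i).

(** The second condition says that adding the weight [(inv_weight i)^-1] brings the lower potential
    back to at most [e], cleared of the denominator of the rank-one formula. *)
Definition admissible i := (0 < inv_weight i) &&
  ((gtr W - e) * (inv_weight i + qf W (a i)) <= qf gram (W *m a i)).

Lemma exists_row_neq0 : exists i, a i != 0.
Proof.
have d0 : delta_mx (Ordinal n0) 0 != 0 :> 'cV[R]_n.
  apply/eqP => /matrixP/(_ (Ordinal n0) 0)/eqP.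
  by rewrite !mxE !eqxx oner_eq0.
have := pM.2 _ d0; rewrite qf_gram.
have [/existsP[i]|] := boolP [exists i, a i != 0]; first by exists i.
rewrite negb_exists => /forallP h; rewrite big1 ?ltxx // => i _.
by have := h i; rewrite negbK => /eqP ->; rewrite dot0l expr0n.
Qed.

(** Strictness makes the denominator in [inv_weight] positive; it comes from a nonzero row. *)
Lemma gtr_upper_lt : gtr Y < e.
Proof.
have d0 : 0 < 1 + 4 * e by have := e0; lra.
have := gtr_shift_up hX hY (ltW d0); have [i ai] := exists_row_neq0.
have : 0 < \sum_i qf gram (Y *m a i).
  rewrite (bigD1 i) //= ltr_pwDl ?sumr_ge0 // => [|j _].
    by apply: pM.2; apply: pdinv_mulmx_neq0 hY ai.
  exact: qf_gram_ge0.
by move=> s0; have := mulr_gt0 d0 s0; have := tX; lra.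
Qed.

(** By [gtr_shift_up] the first summands add up to at most 1/(1 + 4e), which is at most 1 - 2e
    because e <= 1/4; the second ones add up to [gtr Y], which is below e. *)
Lemma sum_inv_weight : \sum_i inv_weight i <= 1 - e.
Proof.
have d0 : 0 < 1 + 4 * e by have := e0; lra.
have := gtr_shift_up hX hY (ltW d0); have Ye := gtr_upper_lt.
have te := tX; rewrite big_split /= -mulr_suml -/(gtr Y); set s := \sum_i _ => le.
have eY : 0 < e - gtr Y by rewrite subr_gt0.
have : s / (e - gtr Y) <= (1 + 4 * e)^-1.
  by rewrite ler_pdivrMr // mulrC ler_pdivlMr //; lra.
have : (1 + 4 * e)^-1 <= 1 - 2 * e.
  rewrite -[(1 + _)^-1]mul1r ler_pdivrMr //.
  have : 0 <= e * (4^-1 - e) by rewrite mulr_ge0 ?subr_ge0 // ltW.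
  by have := e0; nra.
by lra.
Qed.

Lemma inv_weight_gt0 i : a i != 0 -> 0 < inv_weight i.
Proof.
move=> ai; rewrite ltr_wpDl ?divr_ge0 ?qf_gram_ge0 //.
  by rewrite subr_ge0 ltW // gtr_upper_lt.
exact: (pdinv_posdef hY).2.
Qed.

Lemma exists_admissible : exists i, admissible i.
Proof.
have [/existsP[i hi]|] := boolP [exists i, admissible i]; first by exists i.
rewrite negb_exists => /forallP h; have [i0 ai0] := exists_row_neq0.
have lt i : a i != 0 ->
    qf gram (W *m a i) < (gtr W - e) * (inv_weight i + qf W (a i)).
  by move=> ai; have := h i; rewrite /admissible inv_weight_gt0 // ltNge.
have : \sum_i qf gram (W *m a i) <
    \sum_i (gtr W - e) * (inv_weight i + qf W (a i)).
  rewrite (bigD1 i0) //= [X in _ < X](bigD1 i0) //= ltr_leD ?lt //.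
  apply: ler_sum => i _; have [ai|ai] := eqVneq (a i) 0; last by rewrite ltW ?lt.
  by rewrite /inv_weight ai !mulmx0 !qf0 mul0r !addr0 mulr0.
rewrite -mulr_sumr big_split /= -/(gtr W) ltNge => /negP[].
have sw := sum_inv_weight; have te := tZ; have ep := e0; have e4 := e1.
have W0 := gtr_ge0 (pdinv_posdef hW).
have c0 : 0 <= \sum_i inv_weight i.
  apply: sumr_ge0 => i _; rewrite addr_ge0 ?divr_ge0 ?qf_gram_ge0 //.
    by rewrite subr_ge0 ltW // gtr_upper_lt.
  exact: posdef_ge0 (pdinv_posdef hY).
have [We|We] := lerP (gtr W) e.
  apply: (@le_trans _ _ 0); last by apply: sumr_ge0 => i _; apply: qf_gram_ge0.
  by rewrite mulr_le0_ge0 ?subr_le0 ?addr_ge0.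
have tz1 : gtr Z <= 1 by lra.
(* Since [gtr Z <= e], both factors are dominated: [gtr W - e] by [gtr W - gtr Z], and 1 - e +
   [gtr W] by 1 + [gtr W - gtr Z]. *)
apply: le_trans (gtr_shift_down hZ hW tz1).
by apply: ler_pM; lra.
Qed.

Lemma admissible_upper i (c := inv_weight i) : admissible i ->
  pdinv (U + (1 + 4 * e) *: gram - c^-1 *: (a i *m (a i)^T))
    (rank1_update Y (- c^-1) (a i)) /\ gtr (rank1_update Y (- c^-1) (a i)) <= e.
Proof.
case/andP => c0 _; have Ye := gtr_upper_lt; rewrite -/c in c0.
have eY : 0 < e - gtr Y by rewrite subr_gt0.
have ai : a i != 0.
  apply: contraTneq c0 => ai; rewrite /c /inv_weight ai.
  by rewrite mulmx0 !qf0 mul0r addr0 ltxx.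
have z0 : 0 < qf gram (Y *m a i) by apply/pM.2/(pdinv_mulmx_neq0 hY).
have cy : c - qf Y (a i) = qf gram (Y *m a i) / (e - gtr Y).
  by rewrite /c /inv_weight addrK.
have cy0 : 0 < c - qf Y (a i) by rewrite cy divr_gt0.
have dE : 1 + - c^-1 * qf Y (a i) = (c - qf Y (a i)) / c.
  by field; rewrite gt_eqF.
split; first by rewrite -scaleNr; apply: sherman_morrison; rewrite // dE divr_gt0.
(* The weight is chosen so that the new upper potential is exactly [e]. *)
rewrite gtr_rank1_update ?(pdinv_sym hY) // dE cy le_eqVlt; apply/orP; left.
apply/eqP; field; rewrite !gt_eqF //.
Qed.

Lemma admissible_lower i (c := inv_weight i) : admissible i ->
  pdinv (L - gram + c^-1 *: (a i *m (a i)^T))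
    (rank1_update W c^-1 (a i)) /\ gtr (rank1_update W c^-1 (a i)) <= e.
Proof.
case/andP; rewrite -/c => c0 h; have W0 := posdef_ge0 (a i) (pdinv_posdef hW).
have cw0 : 0 < c + qf W (a i) by rewrite ltr_pwDl.
have dE : 1 + c^-1 * qf W (a i) = (c + qf W (a i)) / c.
  by field; rewrite gt_eqF.
split; first by apply: sherman_morrison; rewrite // dE divr_gt0.
rewrite gtr_rank1_update ?(pdinv_sym hW) // dE invf_div mulrA mulVf ?gt_eqF //.
by rewrite mul1r lerBlDr -lerBlDl mulrC ler_pdivlMr.
Qed.

End Barriers.
End Gram.

End Forms.

(** * Weighted Gram matrices, dual vectors and the sparsifier bounds *)

Section MoreGram.
Variables (R : realFieldType) (n : nat) (I : finType).
Implicit Types (a : I -> 'cV[R]_n) (w : I -> R) (S X : 'M[R]_n).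

Lemma eq_wgram a w w' : w =1 w' -> wgram a w = wgram a w'.
Proof. by move=> h; apply: eq_bigr => i _; rewrite h. Qed.

Lemma wgram_add1 a w i c :
  wgram a w + c *: (a i *m (a i)^T) = wgram a (fun j => w j + c *+ (j == i)).
Proof.
rewrite /wgram [in RHS](eq_bigr (fun j => w j *: (a j *m (a j)^T) +
  (c *+ (j == i)) *: (a j *m (a j)^T))) => [|j _]; last by rewrite scalerDl.
rewrite big_split; congr (_ + _); rewrite (bigD1 i) //= eqxx big1 ?addr0 //.
by move=> j /negbTE ->; rewrite scale0r.
Qed.

Lemma scale_wgram a w c : c *: wgram a w = wgram a (fun i => c * w i).
Proof. by rewrite scaler_sumr; apply: eq_bigr => i _; rewrite scalerA. Qed.

(** Covers the intermediate states when the lower barrier is shifted row by row. *)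
Lemma posdef_wgram_le a S w : posdef (S - gram a) -> (forall i, w i <= 1) ->
  posdef (S - wgram a w).
Proof.
move=> pS w1; have -> : S - wgram a w = S - gram a + wgram a (fun i => 1 - w i).
  rewrite -addrA; congr (_ + _); rewrite /gram addrC /wgram -!sumrB.
  by rewrite -sumrN; apply: eq_bigr => i _; rewrite scalerBl addrAC subrr add0r.
apply: posdefD => // [|x]; first exact: wgram_sym.
by rewrite qf_wgram sumr_ge0 // => i _; rewrite mulr_ge0 ?sqr_ge0 ?subr_ge0.
Qed.

Lemma posdefD_wgram a S w : posdef S -> (forall i, 0 <= w i) ->
  posdef (S + wgram a w).
Proof.
move=> pS w0; apply: posdefD => // [|x]; first exact: wgram_sym.
by rewrite qf_wgram sumr_ge0 // => i _; rewrite mulr_ge0 ?sqr_ge0.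
Qed.

Lemma gtr_inv a X : pdinv (gram a) X -> gtr a X = n%:R.
Proof.
move=> h; rewrite -mxtrace1 -h.2 /gram /wgram mulmx_suml linear_sum.
apply: eq_bigr => i _ /=; rewrite scale1r -mulmxA mxtrace_mulC /qf dotE.
by rewrite /mxtrace big_ord1 mulmxA.
Qed.

Lemma gtrZ a c X : gtr a (c *: X) = c * gtr a X.
Proof. by rewrite /gtr mulr_sumr; apply: eq_bigr => i _; rewrite qfZ. Qed.

Lemma pdinvZ S X c : 0 < c -> pdinv S X -> pdinv (c *: S) (c^-1 *: X).
Proof.
move=> c0 [pS SX]; split; first exact: posdefZ.
by rewrite -scalemxAr -scalemxAl scalerA mulVf ?gt_eqF // scale1r.
Qed.

Lemma gram_zero_row a b i :
  b i = 0 -> (forall j, j != i -> b j = a j) ->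
  gram b = gram a - a i *m (a i)^T.
Proof.
move=> bi bj; rewrite /gram /wgram (bigD1 i) //= [in RHS](bigD1 i) //= bi.
rewrite mul0mx scaler0 add0r scale1r [X in X - _]addrC addrK.
by apply: eq_bigr => j ji; rewrite bj.
Qed.

Lemma qf_delta X k : qf X (delta_mx k 0) = X k k.
Proof.
rewrite /qf dot_delta mxE (bigD1 k) //= mxE !eqxx mulr1 big1 ?addr0 // => i ik.
by rewrite mxE (negbTE ik) mulr0.
Qed.

(* A row of leverage score at least 1 is independent of the others. *)
Lemma exists_dual a X i : pdinv (gram a) X -> 1 <= qf X (a i) ->
  exists x, dot (a i) x = 1 /\ forall j, j != i -> dot (a j) x = 0.
Proof.
move=> h q1; have := qf_inv (a i) h; set x := X *m a i; rewrite qf_gram.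
rewrite (bigD1 i) //=; set q := qf X (a i) in q1 *.
have -> : dot (a i) x = q by [].
set r := \sum_(_ | _) _ => qE.
have r0 : 0 <= r by apply: sumr_ge0 => j _; apply: sqr_ge0.
have {qE} q2 : q = 1 /\ r = 0 by split; nra.
exists x; split; first by rewrite -q2.1.
move=> j ji; have /eqP := q2.2; rewrite psumr_eq0 => [|k _]; last exact: sqr_ge0.
by move=> /allP/(_ j (mem_index_enum _)); rewrite ji sqrf_eq0 => /eqP.
Qed.

(** Subtract from [x] the dual vectors of the rows in [K], scaled by the products of these rows with
    [x]. *)
Lemma exists_projection a (K : pred I) x :
  (forall i, K i -> exists y, dot (a i) y = 1 /\
     forall j, j != i -> dot (a j) y = 0) ->
  exists x', (forall i, K i -> dot (a i) x' = 0) /\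
             (forall i, ~~ K i -> dot (a i) x' = dot (a i) x).
Proof.
move=> h; have /fin_all_exists[f hf] i : exists y, K i ->
    dot (a i) y = 1 /\ forall j, j != i -> dot (a j) y = 0.
  by have [/h[y hy]|_] := boolP (K i); [exists y|exists 0].
exists (x - \sum_(i | K i) dot (a i) x *: f i); split=> i Ki; rewrite dotBr dot_sumr.
  rewrite (bigD1 i) //= dotZr (hf i Ki).1 mulr1 big1 ?addr0 ?subrr // => j.
  by case/andP => Kj ji; rewrite dotZr (hf j Kj).2 ?mulr0 // eq_sym.
rewrite big1 ?subr0 // => j Kj; rewrite dotZr (hf j Kj).2 ?mulr0 //.
by apply: contraNneq Ki => ->.
Qed.

Section Final.
Variables (a : I -> 'cV[R]_n) (w : I -> R) (X : 'M[R]_n) (e t nu : R).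
Hypotheses (e0 : 0 < e) (t0 : 0 < t) (nt : nu <= t * e ^+ 2).
Hypotheses (hX : pdinv (gram a) X) (w0 : forall i, 0 <= w i).
Hypothesis pU : posdef ((t * (1 + 4 * e) + nu / e) *: gram a - wgram a w).
Hypothesis pL : posdef (wgram a w - (t - nu / e) *: gram a).

Lemma sparsifier_upper x : qf (wgram a w) x <= t * (1 + 5 * e) * qf (gram a) x.
Proof.
have := posdef_ge0 x pU; rewrite qfB qfZ subr_ge0 => /le_trans; apply.
rewrite ler_wpM2r ?qf_gram_ge0 //.
have : nu / e <= t * e by rewrite ler_pdivrMr // -mulrA -expr2.
by lra.
Qed.

Lemma sparsifier_lower x : t * (1 - e) * qf (gram a) x <= qf (wgram a w) x.
Proof.
have := posdef_ge0 x pL; rewrite qfB qfZ subr_ge0; apply: le_trans.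
rewrite ler_wpM2r ?qf_gram_ge0 //.
have : nu / e <= t * e by rewrite ler_pdivrMr // -mulrA -expr2.
by lra.
Qed.

(** Test the upper bound at [X a_i]: with q the leverage score of row i, that row alone contributes
    w_i q^2, against q from M. *)
Lemma weight_leverage i : w i * qf X (a i) <= t * (1 + 5 * e).
Proof.
have [->|ai] := eqVneq (a i) 0.
  by rewrite qf0 mulr0 mulr_ge0 //; have := e0; have := t0; lra.
have q0 : 0 < qf X (a i) by apply: (pdinv_posdef hX).2.
have := sparsifier_upper (X *m a i); rewrite -(qf_inv _ hX) qf_wgram.
rewrite (bigD1 i) //= -/(qf X (a i)) => h.
rewrite -(ler_pM2r q0); apply: le_trans h.
rewrite -mulrA -expr2 lerDl sumr_ge0 // => j _.
by rewrite mulr_ge0 ?sqr_ge0.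
Qed.

End Final.
End MoreGram.

(** * Approximate square roots and the error of rounding *)

Section Newton.
Variable R : realFieldType.
Implicit Types s x : R.

Definition newton s x : R := (x + s / x) / 2.

(** With y = s/x <= x, the new square exceeds s by (x - y)^2 / 4, and (x - y)^2 <= x^2 - x y = x^2 -
    s. *)
Lemma newtonP s x : 0 < x -> 0 < s -> s <= x ^+ 2 ->
  [/\ 0 < newton s x, s <= newton s x ^+ 2 &
      newton s x ^+ 2 - s <= (x ^+ 2 - s) / 4].
Proof.
move=> x0 s0 sx; rewrite /newton; have y0 : 0 < s / x by rewrite divr_gt0.
have sE : s = x * (s / x) by field; rewrite gt_eqF.
set y := s / x in y0 sE *.
have yx : y <= x by rewrite -(ler_pM2l x0) -sE -expr2.
rewrite sE expr2; split; first by rewrite divr_gt0 ?addr_gt0.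
  have := sqr_ge0 (x - y); rewrite !expr2; nra.
by rewrite !expr2; nra.
Qed.

Lemma iter_newtonP s x k : 0 < x -> 0 < s -> s <= x ^+ 2 ->
  [/\ 0 < iter k (newton s) x, s <= iter k (newton s) x ^+ 2 &
      iter k (newton s) x ^+ 2 - s <= x ^+ 2 / 4 ^+ k].
Proof.
move=> x0 s0 sx; suff [h1 h2 h3] : [/\ 0 < iter k (newton s) x,
    s <= iter k (newton s) x ^+ 2 &
    iter k (newton s) x ^+ 2 - s <= (x ^+ 2 - s) / 4 ^+ k].
  split=> //; apply: le_trans h3 _; rewrite ler_wpM2r ?invr_ge0 ?exprn_ge0 //.
  by rewrite gerBl ltW.
elim: k => [|k [h1 h2 h3]]; first by rewrite expr0 divr1.
have [h4 h5 h6] := newtonP h1 s0 h2; split=> //; apply: le_trans h6 _.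
by rewrite [4 ^+ _]exprSr invfM mulrA ler_wpM2r // invr_ge0.
Qed.

End Newton.

Section SumSquares.
Variables (R : realFieldType) (I : finType) (b : I -> R).

Lemma sum_sqr_le : \sum_i b i ^+ 2 <= (\sum_i `|b i|) ^+ 2.
Proof.
rewrite expr2 mulr_sumr; apply: ler_sum => i _.
rewrite -real_normK ?num_real // expr2 ler_wpM2r //.
by rewrite (bigD1 i) //= lerDl sumr_ge0.
Qed.

Lemma sqr_sum_le : (\sum_i `|b i|) ^+ 2 <= #|I|%:R * \sum_i b i ^+ 2.
Proof.
set r := \sum_i `|b i|; set S := \sum_i b i ^+ 2.
have h i : 2 * `|b i| * r <= #|I|%:R * b i ^+ 2 + S.
  have -> : #|I|%:R * b i ^+ 2 + S = \sum_j (b i ^+ 2 + b j ^+ 2).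
    by rewrite big_split /= sumr_const mulr_natl.
  rewrite mulr_sumr; apply: ler_sum => j _.
  rewrite -[b i ^+ 2]real_normK ?num_real // -[b j ^+ 2]real_normK ?num_real //.
  by have := sqr_ge0 (`|b i| - `|b j|); rewrite !expr2; lra.
have : \sum_i 2 * `|b i| * r <= \sum_i (#|I|%:R * b i ^+ 2 + S).
  exact: ler_sum.
rewrite -mulr_suml -mulr_sumr -/r big_split /= -mulr_sumr -/S sumr_const.
by rewrite -mulr_natl expr2; lra.
Qed.

End SumSquares.

Section Rounding.
Variables (R : realFieldType) (n : nat) (I : finType).
Variables (a : I -> 'cV[R]_n) (w : I -> R) (X : 'M[R]_n) (e t nu : R) (K : nat).
Local Notation N := (#|I|%:R : R).
Hypotheses (e0 : 0 < e) (e1 : e <= 4^-1) (t0 : 0 < t) (nt : nu <= t * e ^+ 2).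
Hypotheses (hX : pdinv (gram a) X) (w0 : forall i, 0 <= w i).
Hypothesis pU : posdef ((t * (1 + 4 * e) + nu / e) *: gram a - wgram a w).
Hypothesis pL : posdef (wgram a w - (t - nu / e) *: gram a).
Hypothesis hK : N * (4 * N ^+ 2) <= e * 4 ^+ K.

(** Rows of weight zero must get exactly 0, or sparsity would be lost. *)
Definition rounded i : R :=
  if w i <= 0 then 0 else
  iter K (newton (w i / t)) (2 * N / \sum_j `|dot (a j) (X *m a i)|).

Lemma rounded_ge0 i : 0 <= rounded i.
Proof.
rewrite /rounded; case: (lerP (w i)) => // wi.
elim: K => [|k IH] /=; first by rewrite divr_ge0 ?mulr_ge0 ?sumr_ge0.
by rewrite divr_ge0 ?addr_ge0 // divr_ge0 // divr_ge0 ?ltW.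
Qed.

(** The Newton error is at most (2N/r_i)^2 / 4^K, while p is at most the leverage score times x^T M
    x, and the score is at most r_i^2; so r_i cancels. *)
Lemma rounded_sqr i x (p := dot (a i) x ^+ 2) :
  w i / t * p <= rounded i ^+ 2 * p <=
    w i / t * p + 4 * N ^+ 2 / 4 ^+ K * qf (gram a) x.
Proof.
have M0 := qf_gram_ge0 a x.
have q0 : 0 <= 4 * N ^+ 2 / 4 ^+ K * qf (gram a) x.
  by rewrite mulr_ge0 // divr_ge0 ?mulr_ge0 ?exprn_ge0.
have [ai|ai] := eqVneq (a i) 0.
  by rewrite /p ai dot0l expr0n /= !mulr0 add0r lexx.
rewrite /rounded; case: (lerP (w i)) => [wi|wi].
  have -> : w i = 0 by apply/eqP; rewrite eq_le wi w0.
  by rewrite mul0r expr0n /= !mul0r add0r lexx.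
have tau0 : 0 < qf X (a i) by apply: (pdinv_posdef hX).2.
have tauE : qf X (a i) = \sum_j dot (a j) (X *m a i) ^+ 2.
  by rewrite (qf_inv _ hX) qf_gram.
set r := \sum_j `|_|; have r_lo := sum_sqr_le (fun j => dot (a j) (X *m a i)).
have r_hi := sqr_sum_le (fun j => dot (a j) (X *m a i)).
rewrite -tauE -/r in r_lo r_hi.
have r0 : 0 < r.
  rewrite lt_neqAle sumr_ge0 // andbT; apply: contraTneq tau0 => r0.
  by rewrite -leNgt (le_trans r_lo) // -r0 expr0n.
have N1 : 1 <= N by rewrite ler1n; apply/card_gt0P; exists i.
have N0 : 0 < N by lra.
have lev := weight_leverage e0 t0 nt hX w0 pU i.
have x0 : 0 < 2 * N / r by rewrite divr_gt0 ?mulr_gt0.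
have s0 : 0 < w i / t by rewrite divr_gt0.
(* The start lies above the root: with q the leverage score, w_i r^2 <= N w_i q <= N t (1 + 5e) <= 4
   N^2 t. *)
have sx : w i / t <= (2 * N / r) ^+ 2.
  rewrite expr_div_n ler_pdivlMr ?exprn_gt0 // mulrAC ler_pdivrMr //.
  apply: (@le_trans _ _ (w i * (N * qf X (a i)))).
    by rewrite ler_wpM2l // ltW.
  apply: (@le_trans _ _ (N * (t * (1 + 5 * e)))).
    by rewrite mulrCA ler_wpM2l // ltW.
  have -> : (2 * N) ^+ 2 * t = N * (t * (4 * N)) by ring.
  rewrite ler_pM2l // ler_pM2l //.
  by have := e1; lra.
have [y0 y1 y2] := iter_newtonP K x0 s0 sx; set y := iter _ _ _ in y0 y1 y2 *.
have p0 : 0 <= p by apply: sqr_ge0.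
have pC : p <= qf X (a i) * qf (gram a) x by rewrite mulrC; apply: cauchy_pdinv.
rewrite ler_wpM2r //= -lerBlDl -mulrBl.
apply: (@le_trans _ _ ((2 * N / r) ^+ 2 / 4 ^+ K * p)); first exact: ler_wpM2r.
apply: (@le_trans _ _ ((2 * N / r) ^+ 2 / 4 ^+ K * (r ^+ 2 * qf (gram a) x))).
  rewrite ler_wpM2l //; first by rewrite divr_ge0 ?sqr_ge0 ?exprn_ge0.
  by rewrite (le_trans pC) // ler_wpM2r.
rewrite le_eqVlt; apply/orP; left; apply/eqP.
by field; rewrite !gt_eqF // ?exprn_gt0.
Qed.

Lemma roundedP x :
  (1 - e) * qf (gram a) x <= \sum_i rounded i ^+ 2 * dot (a i) x ^+ 2 /\
  \sum_i rounded i ^+ 2 * dot (a i) x ^+ 2 <= (1 + 6 * e) * qf (gram a) x.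
Proof.
have M0 := qf_gram_ge0 a x.
have wE : \sum_i w i / t * dot (a i) x ^+ 2 = qf (wgram a w) x / t.
  by rewrite qf_wgram mulr_suml; apply: eq_bigr => i _; rewrite mulrAC.
split.
  apply: (@le_trans _ _ (qf (wgram a w) x / t)).
    rewrite ler_pdivlMr // mulrC mulrA.
    exact: sparsifier_lower e0 nt pL x.
  by rewrite -wE; apply: ler_sum => i _; case/andP: (rounded_sqr i x).
apply: (@le_trans _ _ (\sum_i (w i / t * dot (a i) x ^+ 2 +
    4 * N ^+ 2 / 4 ^+ K * qf (gram a) x))).
  by apply: ler_sum => i _; case/andP: (rounded_sqr i x).
rewrite big_split /= wE sumr_const -[X in _ + X <= _]mulr_natl.
rewrite -[#|xpredT|]/(#|I|).
have : qf (wgram a w) x / t <= (1 + 5 * e) * qf (gram a) x.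
  rewrite ler_pdivrMr // mulrC mulrA.
  exact: sparsifier_upper e0 nt pU x.
have : N * (4 * N ^+ 2 / 4 ^+ K * qf (gram a) x) <= e * qf (gram a) x.
  rewrite !mulrA ler_wpM2r // ler_pdivrMr ?exprn_gt0 //.
  by move: hK; rewrite expr2 !mulrA.
lra.
Qed.

End Rounding.

(** * A loop language with polynomial running time *)

Inductive prog : Type :=
  | PSkip
  | PSetI of nat & iexp
  | PSetR of nat & iexp & iexp & rexp
  | PSeq of prog & prog
  | PIf of test & prog & prog
  | PFor of nat & iexp & prog.

Fixpoint compile (c : prog) : cmd :=
  match c with
  | PSkip => Skip
  | PSetI x e => SetI x e
  | PSetR a i j e => SetR a i j e
  | PSeq c1 c2 => Seq (compile c1) (compile c2)
  | PIf b c1 c2 => If b (compile c1) (compile c2)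
  | PFor x e c1 =>
      Seq (SetI x (ICst 0))
          (While (TNot (TLeI e (IReg x)))
             (Seq (compile c1) (SetI x (IAdd (IReg x) (ICst 1)))))
  end.

Fixpoint regs_mod (c : prog) : seq nat :=
  match c with
  | PSetI x _ => [:: x]
  | PSeq c1 c2 | PIf _ c1 c2 => regs_mod c1 ++ regs_mod c2
  | PFor x _ c1 => x :: regs_mod c1
  | _ => [::]
  end.

Fixpoint arrays_mod (c : prog) : seq nat :=
  match c with
  | PSetR a _ _ _ => [:: a]
  | PSeq c1 c2 | PIf _ c1 c2 => arrays_mod c1 ++ arrays_mod c2
  | PFor _ _ c1 => arrays_mod c1
  | _ => [::]
  end.

(* Loop bounds only mention the input dimensions, which programs never        *)
(* change; hence the running time is polynomial by construction.              *)
Fixpoint bound_exp (e : iexp) : bool :=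
  match e with
  | ICst _ => true
  | IReg x => (x < 2)%N
  | IAdd e1 e2 => bound_exp e1 && bound_exp e2
  | ISub _ _ => false
  end.

Fixpoint wf (c : prog) : bool :=
  match c with
  | PSetI x _ => (1 < x)%N
  | PSeq c1 c2 | PIf _ c1 c2 => wf c1 && wf c2
  | PFor x e c1 => [&& (1 < x)%N, bound_exp e, x \notin regs_mod c1 & wf c1]
  | _ => true
  end.

Fixpoint bound_poly (e : iexp) : {poly nat} :=
  match e with
  | ICst k => k%:P
  | IReg _ => 'X
  | IAdd e1 e2 => bound_poly e1 + bound_poly e2
  | ISub e1 _ => bound_poly e1
  end.

(** The variable stands for a common bound on both dimensions. A conditional is charged for both
    branches, as polynomials have no maximum. In a loop, each round adds a test and an increment;
    the leading 2 is the initialisation and the last test. *)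
Fixpoint cost (c : prog) : {poly nat} :=
  match c with
  | PSeq c1 c2 => cost c1 + cost c2
  | PIf _ c1 c2 => 1 + (cost c1 + cost c2)
  | PFor _ e c1 => 2%:P + bound_poly e * (cost c1 + 2%:P)
  | _ => 1
  end.

Lemma horner_natD (p q : {poly nat}) (K : nat) :
  (p + q).[K] = (p.[K] + q.[K])%N.
Proof. by rewrite hornerD. Qed.

Lemma horner_natM (p q : {poly nat}) (K : nat) :
  (p * q).[K] = (p.[K] * q.[K])%N.
Proof. by rewrite hornerM. Qed.

Lemma horner_nat1 (K : nat) : (1 : {poly nat}).[K] = 1%N.
Proof. by rewrite hornerC. Qed.

(** * Functional semantics, loop invariants and the running time *)

Section Denotation.
Variable R : realType.
Implicit Types s : state R.

Fixpoint for_loop (x : nat) (f : state R -> state R) (k : nat) s : state R :=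
  if k is k'.+1 then set_ireg (f (for_loop x f k' s)) x k else set_ireg s x 0.

Fixpoint den (c : prog) s : state R :=
  match c with
  | PSkip => s
  | PSetI x e => set_ireg s x (ieval s e)
  | PSetR a i j e => set_cell s a (ieval s i) (ieval s j) (reval s e)
  | PSeq c1 c2 => den c2 (den c1 s)
  | PIf b c1 c2 => if teval s b then den c1 s else den c2 s
  | PFor x e c1 => for_loop x (den c1) (ieval s e) s
  end.

Lemma den_skip s : den PSkip s = s. Proof. by []. Qed.

Lemma den_seti x e s : den (PSetI x e) s = set_ireg s x (ieval s e).
Proof. by []. Qed.

Lemma den_setr a i j e s :
  den (PSetR a i j e) s = set_cell s a (ieval s i) (ieval s j) (reval s e).
Proof. by []. Qed.

Lemma den_seq c1 c2 s : den (PSeq c1 c2) s = den c2 (den c1 s).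
Proof. by []. Qed.

Lemma den_if b c1 c2 s :
  den (PIf b c1 c2) s = if teval s b then den c1 s else den c2 s.
Proof. by []. Qed.

Lemma den_ireg c s (y : nat) : y \notin regs_mod c -> ireg (den c s) y = ireg s y.
Proof.
elim: c s => //= [x e|c1 IH1 c2 IH2|b c1 IH1 c2 IH2|x e c1 IH] s.
- by rewrite inE => /negbTE ->.
- by rewrite mem_cat negb_or => /andP[h1 h2]; rewrite IH2 // IH1.
- by rewrite mem_cat negb_or => /andP[h1 h2]; case: ifP => _; rewrite ?IH2 // IH1.
- rewrite inE negb_or => /andP[/negbTE yx h].
  by elim: (ieval s e) => [|k IHk] /=; rewrite yx // IH.
Qed.

Lemma den_cell c s (a : nat) : a \notin arrays_mod c -> cell (den c s) a = cell s a.
Proof.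
elim: c s => //= [a' i j e|c1 IH1 c2 IH2|b c1 IH1 c2 IH2|x e c1 IH] s.
- by rewrite inE => /negbTE ->.
- by rewrite mem_cat negb_or => /andP[h1 h2]; rewrite IH2 // IH1.
- by rewrite mem_cat negb_or => /andP[h1 h2]; case: ifP => _; rewrite ?IH2 // IH1.
- by move=> h; elim: (ieval s e) => [|k IHk] //=; rewrite IH.
Qed.

(** The frame is built in: what the body never assigns keeps its value from before the loop, so that
    an invariant [P] speaks only of what changes. *)
Lemma for_loop_rule (x : nat) e c s (P : nat -> state R -> Prop) :
  x \notin regs_mod c ->
  P 0 (set_ireg s x 0) ->
  (forall k s', (k < ieval s e)%N -> ireg s' x = k ->
     (forall y : nat, y \notin x :: regs_mod c -> ireg s' y = ireg s y) ->
     (forall a : nat, a \notin arrays_mod c -> cell s' a = cell s a) ->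
     P k s' -> P k.+1 (set_ireg (den c s') x k.+1)) ->
  P (ieval s e) (den (PFor x e c) s).
Proof.
move=> xc P0 PS /=; set B := ieval s e in PS *.
suff H : forall k, (k <= B)%N -> [/\ P k (for_loop x (den c) k s),
   ireg (for_loop x (den c) k s) x = k,
   (forall y : nat, y \notin x :: regs_mod c ->
      ireg (for_loop x (den c) k s) y = ireg s y) &
   (forall a : nat, a \notin arrays_mod c ->
      cell (for_loop x (den c) k s) a = cell s a)].
  by case: (H B (leqnn B)).
elim=> [|k IHk] kB /=; rewrite eqxx; split=> //.
- by move=> y; rewrite inE negb_or => /andP[/negbTE ->].
- by case: (IHk (ltnW kB)) => Pk xk hr ha; apply: PS.
- move=> y yh; case: (IHk (ltnW kB)) => _ _ /(_ y yh) <- _.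
  by move: yh; rewrite inE negb_or => /andP[/negbTE -> h]; rewrite den_ireg.
- by move=> a ah; case: (IHk (ltnW kB)) => _ _ _ /(_ a ah) <-; rewrite den_cell.
Qed.

Lemma wf_regs c : wf c -> forall y, (y < 2)%N -> y \notin regs_mod c.
Proof.
elim: c => //= [x e|c1 IH1 c2 IH2|b c1 IH1 c2 IH2|x e c1 IH].
- by move=> x1 y y2; rewrite inE; lia.
- by case/andP => h1 h2 y y2; rewrite mem_cat negb_or IH1 ?IH2.
- by case/andP => h1 h2 y y2; rewrite mem_cat negb_or IH1 ?IH2.
- by case/and4P => x1 _ _ h y y2; rewrite inE negb_or IH // andbT; lia.
Qed.

Lemma ieval_bound e s s' : bound_exp e ->
  (forall y, (y < 2)%N -> ireg s' y = ireg s y) -> ieval s' e = ieval s e.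
Proof.
by move=> + h; elim: e => //= e1 IH1 e2 IH2 /andP[/IH1 -> /IH2 ->].
Qed.

Lemma bound_polyP e s K :
  bound_exp e -> (forall y, (y < 2)%N -> (ireg s y <= K)%N) ->
  (ieval s e <= (bound_poly e).[K])%N.
Proof.
move=> + h; elim: e => //= [k|x /h|e1 IH1 e2 IH2 /andP[/IH1 h1 /IH2 h2]].
- by rewrite hornerC.
- by rewrite hornerX.
- by rewrite hornerD leq_add.
Qed.

Lemma exec_compile c s K : wf c -> (forall y, (y < 2)%N -> (ireg s y <= K)%N) ->
  exists2 t, exec (compile c) s t (den c s) & (t <= (cost c).[K])%N.
Proof.
elim: c s => /= [|x e|a i j e|c1 IH1 c2 IH2|b c1 IH1 c2 IH2|x e c1 IH] s.
- by exists 1; [exact: ExecSkip|rewrite hornerC].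
- by exists 1; [exact: ExecSetI|rewrite hornerC].
- by exists 1; [exact: ExecSetR|rewrite hornerC].
- case/andP => w1 w2 h; have [t1 e1 l1] := IH1 s w1 h.
  have [|t2 e2 l2] := IH2 (den c1 s) w2.
    by move=> y y2; rewrite den_ireg ?h // wf_regs.
  exists (t1 + t2)%N; first exact: ExecSeq e1 e2.
  by rewrite hornerD leq_add.
- case/andP => w1 w2 h; have [t1 e1 l1] := IH1 s w1 h.
  have [t2 e2 l2] := IH2 s w2 h; rewrite !horner_natD horner_nat1.
  case: ifP => hb.
    exists t1.+1; first exact: ExecIfT.
    by rewrite add1n ltnS (leq_trans l1) // leq_addr.
  exists t2.+1; first by apply: ExecIfF; rewrite ?hb.
  by rewrite add1n ltnS (leq_trans l2) // leq_addl.
case/and4P => x1 be xc w1 h; set B := ieval s e.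
have inv k y : (y < 2)%N -> ireg (for_loop x (den c1) k s) y = ireg s y.
  move=> y2; have yx : (y == x) = false by lia.
  by elim: k => [|k IHk] /=; rewrite yx // den_ireg ?wf_regs.
have eB k : ieval (for_loop x (den c1) k s) e = B.
  by apply: ieval_bound => // y; apply: inv.
have xk k : ireg (for_loop x (den c1) k s) x = k.
  by case: k => [|k] /=; rewrite eqxx.
pose W := While (TNot (TLeI e (IReg x)))
  (Seq (compile c1) (SetI x (IAdd (IReg x) (ICst 1)))).
(* Induction on the number [k] of remaining rounds: [exec] unfolds a loop at its first round,
   [for_loop] at its last. *)
suff loop k : (k <= B)%N -> exists2 t, exec W (for_loop x (den c1) (B - k) s) t
    (for_loop x (den c1) B s) & (t <= 1 + k * ((cost c1).[K] + 2))%N.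
  have [t et lt] := loop B (leqnn B); rewrite subnn in et.
  exists (1 + t)%N; first by apply: ExecSeq et; apply: ExecSetI.
  rewrite horner_natD horner_natM horner_natD !hornerC.
  rewrite (leq_trans (leq_add (leqnn 1) lt)) // addnA leq_add2l.
  by rewrite leq_mul2r bound_polyP ?orbT.
elim: k => [|k IHk] kB.
  exists 1; last by [].
  by rewrite subn0; apply: ExecWhileF => /=; rewrite eB xk leqnn.
have [t et lt] := IHk (ltnW kB).
set j := (B - k.+1)%N in IHk *; have jE : (B - k)%N = j.+1 by rewrite /j; lia.
have [|t1 et1 lt1] := IH (for_loop x (den c1) j s) w1.
  by move=> y y2; rewrite inv ?h.
exists ((t1 + 1) + t).+1; last first.
  rewrite mulSn; move: lt lt1; rewrite -?(rwP leP); lia.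
apply: ExecWhileT; last by rewrite jE in et; exact: et.
  by rewrite /= eB xk -ltnNge /j; lia.
apply: ExecSeq et1 _ => /=.
have := ExecSetI (den c1 (for_loop x (den c1) j s)) x (IAdd (IReg x) (ICst 1)).
by rewrite /= den_ireg // xk addn1.
Qed.

End Denotation.

Arguments den : simpl never.

Fixpoint iexp_regs (e : iexp) : seq nat :=
  match e with
  | ICst _ => [::]
  | IReg x => [:: x]
  | IAdd e1 e2 | ISub e1 e2 => iexp_regs e1 ++ iexp_regs e2
  end.

Fixpoint rexp_regs (e : rexp) : seq nat :=
  match e with
  | RCst _ => [::]
  | RCell _ i j => iexp_regs i ++ iexp_regs j
  | RAdd e1 e2 | RMul e1 e2 => rexp_regs e1 ++ rexp_regs e2
  | ROpp e1 | RInv e1 => rexp_regs e1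
  end.

Fixpoint rexp_arrays (e : rexp) : seq nat :=
  match e with
  | RCst _ => [::]
  | RCell a _ _ => [:: a]
  | RAdd e1 e2 | RMul e1 e2 => rexp_arrays e1 ++ rexp_arrays e2
  | ROpp e1 | RInv e1 => rexp_arrays e1
  end.

Declare Scope prog_scope.
Delimit Scope prog_scope with prog.
Bind Scope prog_scope with prog.
Notation "c1 ;; c2" := (PSeq c1 c2)
  (at level 70, right associativity) : prog_scope.

Definition denE := (den_seti, den_setr, den_if, den_skip).

Definition psum x e a i j b : prog :=
  PSeq (PSetR a i j (RCst 0)) (PFor x e (PSetR a i j (RAdd (RCell a i j) b))).

Lemma psum_arrays x e a i j b : arrays_mod (psum x e a i j b) = [:: a; a].
Proof. by []. Qed.

Lemma psum_regs x e a i j b : regs_mod (psum x e a i j b) = [:: x].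
Proof. by []. Qed.

Section Correctness.
Variable R : realType.
Implicit Types s : state R.

Lemma ieval_ext e s s' : {in iexp_regs e, forall y, ireg s' y = ireg s y} ->
  ieval s' e = ieval s e.
Proof.
elim: e => //= [x|e1 IH1 e2 IH2|e1 IH1 e2 IH2] h; first by rewrite h ?inE.
  by rewrite IH1 ?IH2 // => y hy; apply: h; rewrite mem_cat hy ?orbT.
by rewrite IH1 ?IH2 // => y hy; apply: h; rewrite mem_cat hy ?orbT.
Qed.

Lemma reval_ext e s s' : {in rexp_regs e, forall y, ireg s' y = ireg s y} ->
  {in rexp_arrays e, forall a, cell s' a = cell s a} -> reval s' e = reval s e.
Proof.
elim: e => //= [a i j|e1 IH1 e2 IH2|e1 IH1|e1 IH1 e2 IH2|e1 IH1] h k.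
- rewrite k ?inE // !(ieval_ext (s := s) (s' := s')) // => y hy;
    by apply: h; rewrite mem_cat hy ?orbT.
- by rewrite IH1 ?IH2 // => y hy; first [apply: h|apply: k];
    rewrite mem_cat hy ?orbT.
- by rewrite IH1.
- by rewrite IH1 ?IH2 // => y hy; first [apply: h|apply: k];
    rewrite mem_cat hy ?orbT.
- by rewrite IH1.
Qed.

Lemma ieval_set_ireg e s (x : nat) k : x \notin iexp_regs e ->
  ieval (set_ireg s x k) e = ieval s e.
Proof.
move=> xe; apply: ieval_ext => y ye /=; case: eqP => // yx.
by rewrite -yx ye in xe.
Qed.

Lemma state_ext s s' : (forall y, ireg s' y = ireg s y) ->
  (forall a i j, cell s' a i j = cell s a i j) -> s' = s.
Proof.
case: s s' => [i c] [i' c'] /= hi hc.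
by congr State; [apply/funext|apply/funext => a; apply/funext => k; apply/funext].
Qed.

Lemma den_psum (x : nat) e (a : nat) i j b s :
  x \notin iexp_regs e -> x \notin iexp_regs i -> x \notin iexp_regs j ->
  a \notin rexp_arrays b ->
  den (psum x e a i j b) s =
    set_ireg (set_cell s a (ieval s i) (ieval s j)
      (\sum_(k < ieval s e) reval (set_ireg s x k) b)) x (ieval s e).
Proof.
move=> xe xi xj ab; rewrite /psum [LHS]/= /den /=.
set s0 := set_cell s _ _ _ _.
have -> : ieval s0 e = ieval s e by apply: ieval_ext.
elim: (ieval s e) => [|k IHk] /=.
  by rewrite big_ord0.
rewrite IHk /= !(ieval_set_ireg _ _ xi) !(ieval_set_ireg _ _ xj).
set S := \sum_(_ < k) _; set sk := set_cell s _ _ _ S.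
have -> : ieval sk i = ieval s i by apply: ieval_ext.
have -> : ieval sk j = ieval s j by apply: ieval_ext.
rewrite !eqxx big_ord_recr /= -/S.
have -> : reval (set_ireg sk x k) b = reval (set_ireg s x k) b.
  apply: reval_ext => // a' ha'; apply/funext => i'; apply/funext => j' /=.
  by case: eqP ha' ab => //= -> ->.
apply: state_ext => //= [y|a' i' j']; first by case: eqP.
by case: [&& a' == a, i' == ieval s i & j' == ieval s j].
Qed.

End Correctness.

Global Opaque psum.

(** * The sparsification program *)

(* Registers 0 and 1 hold m and n, 2 and 3 are inner loop counters, 4 is the  *)
(* current row, 5 an outer loop counter, 6 the selected row. Array 0 holds    *)
(* the rows of A followed by n further rows, 2 the output, 3 the inverse of   *)
(* the Gram matrix M of the rows, 4 and 5 the inverses of u M - B and B - l   *)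
(* M, 6 scratch scalars, 7 a matrix-vector product, 8 the weights, 9 the      *)
(* products of a vector with all rows, and 10, 11, 12 the quadratic forms of  *)
(* the rows with respect to 4, 5, 3.                                          *)
Local Notation r_m := (IReg 0).
Local Notation r_n := (IReg 1).
Local Notation C0 := (ICst 0).
Local Notation nrows := (IAdd r_m r_n).
Local Notation RDiv x y := (RMul x (RInv y)).
Local Notation RSub x y := (RAdd x (ROpp y)).
Local Notation scal k := (RCell 6 (ICst k) C0).
Local Notation set_scal k e := (PSetR 6 (ICst k) C0 e).
Local Notation eps_cell := (RCell 13 C0 C0).
Local Notation dim_cell := (RCell 13 (ICst 1) C0).
Local Notation twoN_cell := (RCell 13 (ICst 2) C0).
Local Notation delta_cell := (RCell 13 (ICst 3) C0).
Local Notation time_cell := (RCell 14 C0 C0).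
Local Notation new_weight := (RCell 15 C0 C0).
Local Notation upper_trace := (RCell 16 C0 C0).
Local Notation lower_trace := (RCell 16 (ICst 1) C0).

(** * Subroutines: products, rank-one updates and forms of the rows *)

Definition matvec X : prog :=
  PFor 2 r_n (psum 3 r_n 7 (IReg 2) C0
    (RMul (RCell X (IReg 2) (IReg 3)) (RCell 0 (IReg 4) (IReg 3)))).

Lemma matvec_arrays X : arrays_mod (matvec X) = [:: 7; 7]%N.
Proof. by rewrite /= psum_arrays. Qed.

Lemma matvec_regs X : regs_mod (matvec X) = [:: 2; 3]%N.
Proof. by rewrite /= psum_regs. Qed.

Definition rank1 X c : prog :=
  set_scal 0 c ;;
  matvec X ;;
  psum 3 r_n 6 (ICst 1) C0
    (RMul (RCell 0 (IReg 4) (IReg 3)) (RCell 7 (IReg 3) C0)) ;;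
  set_scal 2 (RDiv (scal 0) (RAdd (RCst 1) (RMul (scal 0) (scal 1)))) ;;
  PFor 2 r_n (PFor 3 r_n (PSetR X (IReg 2) (IReg 3)
    (RAdd (RCell X (IReg 2) (IReg 3))
       (ROpp (RMul (scal 2)
                (RMul (RCell 7 (IReg 2) C0) (RCell 7 (IReg 3) C0))))))).

Lemma rank1_arrays X c : arrays_mod (rank1 X c) = [:: 6; 7; 7; 6; 6; 6; X]%N.
Proof. by rewrite /= !psum_arrays. Qed.

Lemma rank1_regs X c : regs_mod (rank1 X c) = [:: 2; 3; 3; 2; 3]%N.
Proof. by rewrite /= !psum_regs. Qed.

Definition row_products : prog :=
  PFor 2 nrows
   (psum 3 r_n 9 (IReg 2) C0
      (RMul (RCell 0 (IReg 2) (IReg 3)) (RCell 7 (IReg 3) C0)) ;;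
    PIf (TLeR (RCst 0) (RCell 9 (IReg 2) C0)) PSkip
      (PSetR 9 (IReg 2) C0 (ROpp (RCell 9 (IReg 2) C0)))).

Lemma row_products_arrays : arrays_mod row_products = [:: 9; 9; 9]%N.
Proof. by rewrite /= psum_arrays. Qed.

Lemma row_products_regs : regs_mod row_products = [:: 2; 3]%N.
Proof. by rewrite /= psum_regs. Qed.

(** M itself is never stored: its form at [X a_i] is the sum of the squared products with all rows,
    in column 1. Column 2 holds the sum of their absolute values, the r_i of the Newton start. *)
Definition row_forms X d : prog :=
  PFor 4 nrows
   (matvec X ;; row_products ;;
    psum 3 r_n d (IReg 4) C0
      (RMul (RCell 0 (IReg 4) (IReg 3)) (RCell 7 (IReg 3) C0)) ;;
    psum 3 nrows d (IReg 4) (ICst 1)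
      (RMul (RCell 9 (IReg 3) C0) (RCell 9 (IReg 3) C0)) ;;
    psum 3 nrows d (IReg 4) (ICst 2) (RCell 9 (IReg 3) C0)).

Lemma row_forms_arrays X d :
  arrays_mod (row_forms X d) = [:: 7; 7; 9; 9; 9; d; d; d; d; d; d]%N.
Proof. by rewrite /= !psum_arrays. Qed.

Lemma row_forms_regs X d :
  regs_mod (row_forms X d) = [:: 4; 2; 3; 2; 3; 3; 3; 3]%N.
Proof. by rewrite /= !psum_regs. Qed.

Definition frameE := (psum_arrays, psum_regs, matvec_arrays, matvec_regs,
  rank1_arrays, rank1_regs,
  row_products_arrays, row_products_regs, row_forms_arrays, row_forms_regs).

Ltac side := by rewrite ?frameE /= ?frameE ?inE /=; lia.

Section Correctness.
Variable R : realType.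
Implicit Types s : state R.

Definition mat n s X : 'M[R]_n := \matrix_(i, j) cell s X i j.
Definition row_vec n s i : 'cV[R]_n := \col_j cell s 0 i j.

Lemma mat_ext n s s' X : cell s' X = cell s X -> mat n s' X = mat n s X.
Proof. by move=> h; apply/matrixP => i j; rewrite !mxE h. Qed.

Lemma row_vec_ext n s s' i : cell s' 0 = cell s 0 ->
  row_vec n s' i = row_vec n s i.
Proof. by move=> h; apply/matrixP => k j; rewrite !mxE h. Qed.

(** Each cell is written once, so its expression may read the old value at the same position, as
    rank-one updates do. *)
Lemma den_map2 s (X : nat) e1 e2 b (f : nat -> nat -> R) :
  bound_exp e1 -> bound_exp e2 ->
  (forall s' i j, ireg s' 2 = i -> ireg s' 3 = j ->
     (forall y : nat, y \notin [:: 2; 3]%N -> ireg s' y = ireg s y) ->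
     (forall a : nat, a \notin [:: X] -> cell s' a = cell s a) ->
     cell s' X i j = cell s X i j -> reval s' b = f i j) ->
  forall i j, (i < ieval s e1)%N -> (j < ieval s e2)%N ->
  cell (den (PFor 2 e1 (PFor 3 e2 (PSetR X (IReg 2) (IReg 3) b))) s) X i j =
    f i j.
Proof.
move=> be1 be2 hb i j i1 j2; set B := ieval s e2 in j2 *.
pose P k s' := forall i j, cell s' X i j =
  if (i < k)%N && (j < B)%N then f i j else cell s X i j.
suff: P (ieval s e1) (den (PFor 2 e1 (PFor 3 e2 (PSetR X (IReg 2) (IReg 3) b))) s).
  by move=> ->; rewrite i1 j2.
apply: (for_loop_rule (x := 2%N) (P := P)) => // k s1 ks s1k hr ha Pk.
pose Q l s' := forall i j, cell s' X i j =
  if ((i < k)%N && (j < B)%N) || ((i == k) && (j < l)%N)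
  then f i j else cell s X i j.
have eB : ieval s1 e2 = B.
  by apply: ieval_bound => // y y2; apply: hr; side.
suff QB : Q B (den (PFor 3 e2 (PSetR X (IReg 2) (IReg 3) b)) s1).
  move=> i' j' /=.
  rewrite QB ltnS [in RHS]leq_eqVlt andb_orl orbC.
  by congr (if _ then _ else _); rewrite orbC.
rewrite -[in Q B]eB.
apply: (for_loop_rule (x := 3%N) (P := Q)) => // [|l s2 ls s2l hr2 ha2 Ql].
  by move=> i' j' /=; rewrite Pk andbF orbF.
rewrite denE => i' j' /=; have s2k : ireg s2 2 = k by rewrite hr2.
rewrite s2k s2l eqxx /= Ql ltnS [in RHS](leq_eqVlt j').
have [->|ik] := eqVneq i' k; rewrite /= ?orbF //.
have [->|jl] := eqVneq j' l; rewrite /= ?orbF //.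
rewrite ltnn /=; apply: hb => //.
- move=> y; rewrite !inE => y23; rewrite hr2 ?hr //; side.
- move=> a; rewrite inE => aX; rewrite ha2 ?ha //; side.
- by rewrite Ql !ltnn andbF.
Qed.

Lemma matvecP n s (X : nat) (k : 'I_n) : X != 7%N -> ireg s 1 = n ->
  cell (den (matvec X) s) 7 k 0 = (mat n s X *m row_vec n s (ireg s 4)) k 0.
Proof.
move=> X7 sn; pose P i s' := forall k : 'I_n, (k < i)%N ->
  cell s' 7 k 0 = (mat n s X *m row_vec n s (ireg s 4)) k 0.
suff H : P n (den (matvec X) s) by exact: H.
rewrite -[in P n]sn; apply: (for_loop_rule (x := 2%N) (e := r_n) (P := P)) => //.
move=> i s' si s'i hr ha Pi j.
rewrite den_psum //; last by side.
rewrite /= s'i (hr 1%N) // sn => ji.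
rewrite andbT; case: eqP => [jE|/eqP jE]; last first.
  by apply: Pi; rewrite ltn_neqAle jE.
rewrite mxE; apply: eq_bigr => l _.
by rewrite /= (ha X) ?(ha 0%N) ?(hr 4%N) // ?mxE ?s'i ?jE //; side.
Qed.

Opaque matvec.

Lemma rank1P n s (X : nat) c : (X < 6)%N -> (0 < X)%N -> ireg s 1 = n ->
  mat n (den (rank1 X c) s) X =
  rank1_update (mat n s X) (reval s c) (row_vec n s (ireg s 4)).
Proof.
move=> X6 X0 sn; rewrite /rank1 4!den_seq !denE.
set s1 := set_cell s 6 0 0 _.
set s2 := den (matvec X) s1.
have y2 (k : 'I_n) : cell s2 7 k 0 = (mat n s X *m row_vec n s (ireg s 4)) k 0.
  rewrite matvecP //; last by side.
  rewrite (@mat_ext n s s1 X) //=; apply/funext => i; apply/funext => j.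
  by rewrite /s1 /=; have -> : (X == 6)%N = false by lia.
have h2 (a : nat) : a \notin [:: 6; 7]%N -> cell s2 a = cell s a.
  rewrite !inE => h; rewrite den_cell; last by side.
  by apply/funext => i; apply/funext => j /=; case: eqP h => // ->.
have r2 (x : nat) : x \notin [:: 2; 3]%N -> ireg s2 x = ireg s x.
  by rewrite !inE => h; rewrite den_ireg //; side.
have c2 : cell s2 6 0 0 = reval s c by rewrite den_cell.
rewrite den_psum //.
have sn2 : ireg s2 1 = n by rewrite r2.
set s3 := set_cell _ 6 2 0 _.
have n3 : ireg s3 1 = n by [].
apply/matrixP => i j; rewrite !mxE.
rewrite (den_map2 (s := s3) (f := fun i j => cell s3 X i j -
  cell s3 6 2 0 * (cell s3 7 i 0 * cell s3 7 j 0))) //=; last 3 first.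
- move=> s' i' j' -> -> hr ha -> /=.
  by rewrite (ha 6%N) ?(ha 7%N) //; side.
- by rewrite sn2.
- by rewrite sn2.
have -> : (X == 6)%N = false by lia.
rewrite !y2 (h2 X) ?(h2 0%N) // ?sn2 ?c2 //=; last by side.
rewrite big_ord1 !mxE (r2 4%N) //.
have -> : \sum_(k < n) cell s 0 (ireg s 4) k * cell s2 7 k 0 =
    qf (mat n s X) (row_vec n s (ireg s 4)).
  by apply: eq_bigr => k _; rewrite y2 !mxE.
by [].
Qed.

Opaque rank1.

Lemma row_productsP n s i : ireg s 1 = n -> (i < ireg s 0 + n)%N ->
  cell (den row_products s) 9 i 0 =
  `|dot (row_vec n s i) (\col_k cell s 7 k 0)|.
Proof.
move=> sn iN; pose P k s' := forall i, (i < k)%N ->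
  cell s' 9 i 0 = `|dot (row_vec n s i) (\col_k cell s 7 k 0)|.
suff H : P (ireg s 0 + n)%N (den row_products s) by exact: H.
rewrite -{1}sn; apply: (for_loop_rule (x := 2%N) (e := nrows) (P := P)).
- by [].
- by [].
move=> k s' ks s'k hr ha Pk j; rewrite den_seq den_psum //.
set t := set_ireg _ 3 _ => jk.
have t2 : ireg t 2 = k by [].

have tk : cell t 9 k 0 = dot (row_vec n s k) (\col_k cell s 7 k 0).
  rewrite /t /= s'k eqxx /= (hr 1%N) // sn; apply: eq_bigr => l _.
  by rewrite (ha 0%N) // (ha 7%N) // !mxE.
have tj : j != k -> cell t 9 j 0 = cell s' 9 j 0.
  by move=> jk'; rewrite /t /= s'k (negbTE jk').
clearbody t; rewrite denE; have [jE|jk'] := eqVneq j k.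
  rewrite jE /= t2 tk; case: lerP => h /=; first by rewrite tk ger0_norm.
  by rewrite t2 eqxx /= tk ltr0_norm.
have jlk : (j < k)%N by lia.
case: ifP => _ /=; first by rewrite tj ?Pk.
by rewrite t2 (negbTE jk') /= tj ?Pk.
Qed.

Opaque row_products.

Lemma row_formsP n s X d r (N := (ireg s 0 + n)%N)
    (z := mat n s X *m row_vec n s r) :
  (0 < X < 6)%N -> (9 < d)%N -> ireg s 1 = n -> (r < N)%N ->
  [/\ cell (den (row_forms X d) s) d r 0 = qf (mat n s X) (row_vec n s r),
      cell (den (row_forms X d) s) d r 1 =
        \sum_(i < N) dot (row_vec n s i) z ^+ 2 &
      cell (den (row_forms X d) s) d r 2 =
        \sum_(i < N) `|dot (row_vec n s i) z| ].
Proof.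
move=> hX hd sn; rewrite {}/z; pose P k s' := forall r, (r < k)%N ->
  let z := mat n s X *m row_vec n s r in
  [/\ cell s' d r 0 = qf (mat n s X) (row_vec n s r),
      cell s' d r 1 = \sum_(i < N) dot (row_vec n s i) z ^+ 2 &
      cell s' d r 2 = \sum_(i < N) `|dot (row_vec n s i) z| ].
suff H : P N (den (row_forms X d) s) by move=> rN; apply: (H r).
have -> : N = ieval s nrows by rewrite /= sn.
apply: (for_loop_rule (x := 4%N) (e := nrows) (P := P)).
- by rewrite /= !frameE.
- by [].
move=> k s' ks s'k hr ha Pk j; rewrite 4!den_seq.
set s1 := den (matvec X) s'; set s2 := den row_products s1.
rewrite !den_psum //; try side.
have s20 : cell s2 0 = cell s 0.
  by rewrite !den_cell ?ha //; side.
have r0 : ireg s2 0 = ireg s 0 by rewrite !den_ireg ?hr //; side.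
have r1 : ireg s2 1 = n by rewrite !den_ireg ?hr //; side.
have r4 : ireg s2 4 = k by rewrite !den_ireg ?s'k //; side.
have s27 (l : 'I_n) : cell s2 7 l 0 = (mat n s X *m row_vec n s k) l 0.
  rewrite den_cell; last by side.
  rewrite matvecP; try side; last by rewrite hr //; side.
  rewrite (@mat_ext n s s'); last by apply: ha; side.
  by rewrite (@row_vec_ext n s s') ?s'k //; apply: ha; side.
have s29 i : (i < N)%N -> cell s2 9 i 0 =
    `|dot (row_vec n s i) (mat n s X *m row_vec n s k)|.
  move=> iN; have i0 : ireg s1 0 = ireg s 0 by rewrite !den_ireg ?hr //; side.
  have i1 : ireg s1 1 = n by rewrite !den_ireg ?hr //; side.
  rewrite (@row_productsP n) ?i0 //.
  have a0 : cell s1 0 = cell s 0 by rewrite !den_cell ?ha //; side.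
  rewrite (@row_vec_ext n s s1) //; congr (`|dot _ _|).
  by apply/matrixP => l j0; rewrite (ord1 j0) mxE -s27 [cell s2 7]den_cell //; side.
have s2d : cell s2 d = cell s' d by rewrite !den_cell //; side.
clearbody s2 => /=; rewrite r4 r1 r0 eqxx /= -/N.
have -> : (9 == d)%N = false by lia.
rewrite s20 s2d; have [->|jk] := eqVneq j k; last first.
  by move=> h; apply: Pk; lia.
move=> _ /=; split.
- by apply: eq_bigr => l _; rewrite s27 !mxE.
- apply: eq_bigr => l _; rewrite s29 //.
  by rewrite -expr2 real_normK // num_real.
- by apply: eq_bigr => l _; rewrite s29.
Qed.

End Correctness.

(** * Completing the rows of A to full column rank *)

Definition init_rows : prog :=
  PFor 5 r_n (PSetR 0 (IAdd r_m (IReg 5)) (IReg 5) (RCst 1) ;;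
              PSetR 3 (IReg 5) (IReg 5) (RCst 1)).

(** The row tested is still a unit vector, so its leverage score is a diagonal entry of the inverse.
    Below 1, the row can go and M stays definite; otherwise [exists_dual] shows it independent of
    the others. *)
Definition prune_row : prog :=
  PIf (TNot (TLeR (RCst 1) (RCell 3 (IReg 5) (IReg 5))))
    (PSetI 4 (IAdd r_m (IReg 5)) ;; rank1 3 (ROpp (RCst 1)) ;;
     PSetR 0 (IAdd r_m (IReg 5)) (IReg 5) (RCst 0))
    PSkip.

Definition prepare : prog :=
  init_rows ;; PFor 4 r_m (rank1 3 (RCst 1)) ;; PFor 5 r_n prune_row.

Section Correctness.
Variable R : realType.
Implicit Types s : state R.

Definition rows n N s (i : 'I_N) : 'cV[R]_n := row_vec n s i.

Lemma rows_ext n N s s' : cell s' 0 = cell s 0 -> @rows n N s' = @rows n N s.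
Proof. by move=> h; apply/funext => i; apply: row_vec_ext. Qed.

(** Definiteness of all partial sums makes every denominator met on the way positive, by
    [rank1_denom_gt0]. *)
Lemma rank1_loopP n N s (X : nat) c gamma e (S : 'M[R]_n)
    (a := @rows n N s) (B := ieval s e) :
  (0 < X < 6)%N -> ireg s 1 = n -> (B <= N)%N ->
  (forall s',
     (forall a : nat, a \notin [:: 6; 7; X]%N -> cell s' a = cell s a) ->
     reval s' c = gamma) ->
  pdinv S (mat n s X) ->
  (forall k, (k <= B)%N ->
     posdef (S + gamma *: wgram a (fun i => (i < k)%N%:R))) ->
  pdinv (S + gamma *: wgram a (fun i => (i < B)%N%:R))
    (mat n (den (PFor 4 e (rank1 X c)) s) X).
Proof.
move=> hX sn BN hc hS hp.
apply: (for_loop_rule (x := 4%N) (P := fun k s' =>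
  pdinv (S + gamma *: wgram a (fun i => (i < k)%N%:R)) (mat n s' X))).
- by rewrite !frameE.
- rewrite (@eq_wgram _ _ _ _ _ (fun=> 0)) //.
  rewrite /wgram big1 ?scaler0 ?addr0 // => i _; exact: scale0r.
move=> k s' kB s'k hr ha inv.
rewrite (@mat_ext _ n (den (rank1 X c) s')) // rank1P; try lia;
  last by rewrite hr ?frameE.
have kN : (k < N)%N by apply: leq_trans kB BN.
rewrite hc; last first.
  by move=> a' ha'; apply: ha; move: ha'; rewrite !frameE !inE; lia.
have -> : row_vec n s' (ireg s' 4) = a (Ordinal kN).
  by rewrite s'k; apply: row_vec_ext; rewrite ha // !frameE !inE; lia.
set v := a _.
have E : S + gamma *: wgram a (fun i => (i < k.+1)%N%:R) =
    S + gamma *: wgram a (fun i => (i < k)%N%:R) + gamma *: (v *m v^T).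
  rewrite -addrA -scalerDr -[v *m v^T]scale1r wgram_add1; congr (_ + _ *: _).
  apply: eq_wgram => i; rewrite -val_eqE /= ltnS leq_eqVlt.
  by case: ltngtP; rewrite ?addr0 ?add0r.
rewrite E; apply: sherman_morrison => //; apply: rank1_denom_gt0 inv _.
by rewrite -E; apply: hp.
Qed.

Section Prepare.
Variables (m n : nat) (A : 'M[R]_(m, n)) (eps : R).
Let s0 := init_state A eps.
Let N := (m + n)%N.

Lemma init_rowsP (s1 := den init_rows s0) :
  [/\ forall i : 'I_m, row_vec n s1 i = (row i A)^T,
      forall k : 'I_n, row_vec n s1 (m + k) = delta_mx k 0 &
      mat n s1 3 = 1%:M].
Proof.
have [h0 h3] : (forall i j, cell s1 0 i j =
      if (m <= i < m + n)%N && (j == (i - m)%N) then 1 else cell s0 0 i j) /\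
    (forall i j, cell s1 3 i j = ((i < n)%N && (i == j))%:R).
  apply: (for_loop_rule (x := 5%N) (e := r_n) (c := PSeq _ _) (P := fun k s' =>
    (forall i j, cell s' 0 i j =
      if (m <= i < m + k)%N && (j == (i - m)%N) then 1 else cell s0 0 i j) /\
    (forall i j, cell s' 3 i j = ((i < k)%N && (i == j))%:R))) => //.
    split=> i j; last by [].
    by rewrite addn0; case: ifP => //; lia.
  move=> k s' kn s'k hr ha [h0 h3]; rewrite den_seq !denE; split=> i j /=.
    rewrite s'k (hr 0%N) //= h0.
    by case: ifP => h1; case: ifP => h2 //; try case: ifP => h4 //; lia.
  rewrite s'k h3 [in RHS]ltnS [in RHS]leq_eqVlt.
  case: (eqVneq i k) => [->|ik] /=; last by [].
  by rewrite ltnn eq_sym; case: eqP.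
split.
- move=> i; apply/matrixP => j l; rewrite !mxE h0 /=.
  by rewrite leqNgt ltn_ord /= !valK.
- move=> k; apply/matrixP => j l; rewrite (ord1 l) !mxE h0 andbT.
  rewrite leq_addr ltn_add2l ltn_ord /= addKn.
  rewrite [(j : nat) == k]val_eqE; case: eqP => // jk.
  by rewrite insubF ?ltn_ord // ltnNge leq_addr.
- by apply/matrixP => i j; rewrite !mxE h3 ltn_ord val_eqE.
Qed.

(** A unit row already examined is either gone or has a dual vector; the latter stays valid later
    because further pruning only sets rows to zero. *)
Definition pruned k s' := [/\ forall i : 'I_m, row_vec n s' i = (row i A)^T,
  forall j : 'I_n, (k <= j)%N -> row_vec n s' (m + j) = delta_mx j 0,
  pdinv (gram (@rows n N s')) (mat n s' 3) &
  forall j : 'I_n, (j < k)%N -> row_vec n s' (m + j) = 0 \/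
    exists y, dot (row_vec n s' (m + j)) y = 1 /\
      forall i : 'I_N, val i != (m + j)%N -> dot (row_vec n s' i) y = 0].

Lemma prune_rowP s' (k : 'I_n) : ireg s' 0 = m -> ireg s' 1 = n ->
  ireg s' 5 = k -> pruned k s' -> pruned k.+1 (den prune_row s').
Proof.
move=> sm sn s'k [hA hd hX hdual]; rewrite /prune_row denE /= s'k.
have Xkk : cell s' 3 k k = qf (mat n s' 3) (row_vec n s' (m + k)).
  by rewrite hd // qf_delta mxE.
have mk : (m + k < N)%N by rewrite ltn_add2l.
pose mk' : 'I_N := Ordinal mk.
case: ifP => h; last first.
  rewrite denE; split=> // [j kj|j]; first by apply: hd; apply: ltnW.
  rewrite ltnS leq_eqVlt => /orP[/eqP/val_inj->|]; last exact: hdual.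
  right; have := @exists_dual _ _ _ (@rows n N s') (mat n s' 3) mk' hX.
  move=> /(_ _)[|y [y1 y0]].
    by rewrite -Xkk leNgt; move: h; rewrite -ltNge => ->.
  by exists y; split=> // i im; apply: y0.
rewrite 2!den_seq !denE /=; set s1 := set_ireg s' 4 _; set s2 := den _ s1.
have s20 : cell s2 0 = cell s' 0 by rewrite den_cell //; side.
have r0 : ireg s2 0 = m by rewrite den_ireg //; side.
have r5 : ireg s2 5 = k by rewrite den_ireg //; side.
have X2 : mat n s2 3 = rank1_update (mat n s' 3) (- 1) (row_vec n s' (m + k)).
  by rewrite rank1P //= sm s'k.
clearbody s2; set s3 := set_cell s2 _ _ _ _.
have row3 i : row_vec n s3 i = if i == (m + k)%N then 0 else row_vec n s' i.
  apply/matrixP => j l; rewrite (ord1 l) !mxE /s3 /= r0 r5 s20.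
  have [->|] := eqVneq i (m + k)%N; rewrite ?mxE //=.
  case: eqP => // jk; move: (hd k (leqnn k)) => /matrixP/(_ j 0).
  by rewrite !mxE andbT -val_eqE /=; case: eqP.
have ltm (i : 'I_m) : ((i : nat) == m + k)%N = false.
  by have := ltn_ord i; lia.
split.
- by move=> i; rewrite row3 ltm.
- by move=> j kj; rewrite row3 eqn_add2l gtn_eqF // hd // ltnW.
- rewrite (@mat_ext _ n s2 s3) // X2.
  rewrite (gram_zero_row (a := @rows n N s') (i := mk')); last 2 first.
  + by rewrite /rows row3 eqxx.
  + by move=> j jm; rewrite /rows row3 ifN.
  rewrite -scaleN1r; apply: sherman_morrison => //.
  by rewrite mulN1r subr_gt0 -Xkk ltNge.
- move=> j; rewrite ltnS leq_eqVlt row3 eqn_add2l => /orP[->|jk]; first by left.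
  rewrite ltn_eqF //; case: (hdual j jk) => [|[y [y1 y0]]]; first by left.
  right; exists y; split=> // i ij; rewrite row3.
  by case: eqP => // _; [rewrite dot0l|exact: y0].
Qed.

Lemma prepareP (s1 := den prepare s0) :
  [/\ pdinv (gram (@rows n N s1)) (mat n s1 3),
      forall i : 'I_m, row_vec n s1 i = (row i A)^T &
      forall x, exists x',
        (forall i : 'I_N, (m <= i)%N -> dot (row_vec n s1 i) x' = 0) /\
        (forall i : 'I_N, (i < m)%N ->
           dot (row_vec n s1 i) x' = dot (row_vec n s1 i) x)].
Proof.
have [hA hd hX] := init_rowsP; rewrite /s1 /prepare 2!den_seq.
set t1 := den init_rows s0 in hA hd hX *.
have r0 : ireg t1 0 = m by rewrite den_ireg.
have r1 : ireg t1 1 = n by rewrite den_ireg.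
clearbody t1; pose b := @rows n N t1.
have W : wgram b (fun i => (m <= i)%N%:R) = 1%:M.
  rewrite /wgram big_split_ord /= big1 ?add0r => [|i _]; last first.
    by rewrite leqNgt ltn_ord scale0r.
  rewrite [RHS]mx1_sum_delta; apply: eq_bigr => i _.
  by rewrite /b /rows hd leq_addr scale1r trmx_delta mul_delta_mx.
have := @rank1_loopP n N t1 3 (RCst 1) 1 r_m 1%:M isT r1.
rewrite /= r0 leq_addr hX => /(_ isT (fun _ _ => erefl)) hX2.
have {hX2} : pdinv (gram b) (mat n (den (PFor 4 r_m (rank1 3 (RCst 1))) t1) 3).
  have -> : gram b = 1%:M + 1 *: wgram b (fun i => (i < m)%N%:R).
    rewrite -W scale1r -big_split; apply: eq_bigr => i _ /=.
    by rewrite -scalerDl; congr (_ *: _); case: ltnP; rewrite ?addr0 ?add0r.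
  apply: hX2 => [|k _]; first by split; [exact: posdef1|exact: mul1mx].
  by rewrite scale1r; apply: posdefD_wgram => // ; exact: posdef1.
set t2 := den _ t1 => hX2.
have t20 : cell t2 0 = cell t1 0 by rewrite den_cell //; side.
have q0 : ireg t2 0 = m by rewrite den_ireg //; side.
have q1 : ireg t2 1 = n by rewrite den_ireg //; side.
rewrite /b -(rows_ext _ _ t20) in hX2.
clearbody t2.
have : pruned (ieval t2 r_n) (den (PFor 5 r_n prune_row) t2).
  apply: (for_loop_rule (x := 5%N) (P := pruned)) => //.
  - split=> //= [i|j _]; first by rewrite -hA; apply: row_vec_ext.
    by rewrite -hd; apply: row_vec_ext.
  - move=> k s' /=; rewrite q1 => kn s'k hr ha inv.
    apply: (@prune_rowP s' (Ordinal kn)) => //; rewrite hr //; side.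
set t3 := den _ t2; rewrite /= q1 => -[iA _ iX idual]; split=> // x.
(* Project away the added rows that survived; the removed ones are zero and orthogonal to
   everything. *)
have [|x' [x'0 x'1]] := @exists_projection _ _ _ (@rows n N t3)
    (fun i => (m <= i)%N && (@rows n N t3 i != 0)) x.
  move=> i /andP[mi i0].
  have jn : (i - m < n)%N by rewrite ltn_subLR.
  have ji : (m + Ordinal jn)%N = i by rewrite /= subnKC.
  case: (idual (Ordinal jn) jn); rewrite ji; first by move/eqP; rewrite (negbTE i0).
  by case=> y [y1 y0]; exists y; split=> // j ij; apply: y0.
exists x'; split=> i im.
  have [->|i0] := eqVneq (row_vec n t3 i) 0; first exact: dot0l.
  by apply: x'0; rewrite im.
by apply: x'1; rewrite leqNgt im.
Qed.

End Prepare.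
End Correctness.

(** * Initial barriers and one step of the process *)

Definition setup : prog :=
  PSetR 13 C0 C0 (RDiv (RCell 1 C0 C0) (RCst 4)) ;;
  psum 2 r_n 13 (ICst 1) C0 (RCst 1) ;;
  psum 2 nrows 13 (ICst 2) C0 (RCst 2) ;;
  PSetR 13 (ICst 3) C0 (RAdd (RCst 1) (RMul (RCst 4) eps_cell)) ;;
  PFor 2 r_n (PFor 3 r_n (PSetR 4 (IReg 2) (IReg 3)
    (RMul (RDiv eps_cell dim_cell) (RCell 3 (IReg 2) (IReg 3))))) ;;
  PFor 2 r_n (PFor 3 r_n (PSetR 5 (IReg 2) (IReg 3)
    (RMul (RDiv eps_cell dim_cell) (RCell 3 (IReg 2) (IReg 3))))).

(** Later admissible rows overwrite earlier ones, so the last one is selected. *)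
Definition select : prog :=
  PFor 4 nrows
   (set_scal 7 (RAdd (RDiv (RCell 10 (IReg 4) (ICst 1))
                       (RSub eps_cell upper_trace))
                  (RCell 10 (IReg 4) C0)) ;;
    PIf (TAnd (TNot (TLeR (scal 7) (RCst 0)))
           (TLeR (RMul (RSub lower_trace eps_cell)
                    (RAdd (scal 7) (RCell 11 (IReg 4) C0)))
                 (RCell 11 (IReg 4) (ICst 1))))
      (PSetI 6 (IReg 4) ;; PSetR 15 C0 C0 (RInv (scal 7)))
      PSkip).

Definition shift : prog :=
  PFor 4 nrows (rank1 4 delta_cell) ;;
  PFor 4 nrows (rank1 5 (ROpp (RCst 1))) ;;
  row_forms 4 10 ;;
  row_forms 5 11 ;;
  psum 2 nrows 16 C0 C0 (RCell 10 (IReg 2) C0) ;;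
  psum 2 nrows 16 (ICst 1) C0 (RCell 11 (IReg 2) C0).

Definition update : prog :=
  PSetI 4 (IReg 6) ;;
  PSetR 8 (IReg 6) C0 (RAdd (RCell 8 (IReg 6) C0) new_weight) ;;
  rank1 4 (ROpp new_weight) ;;
  rank1 5 new_weight ;;
  PSetR 14 C0 C0 (RAdd time_cell (RCst 1)).

Definition bss_step : prog := shift ;; select ;; update.

Section Correctness.
Variable R : realType.
Implicit Types s : state R.

Lemma selectP s N
  (c := fun r =>
    cell s 10 r 1 / (cell s 13 0 0 - cell s 16 0 0) + cell s 10 r 0)
  (good := fun r => (0 < c r) &&
    ((cell s 16 1 0 - cell s 13 0 0) * (c r + cell s 11 r 0) <= cell s 11 r 1))
  (s' := den select s) :
  (ireg s 0 + ireg s 1)%N = N -> (exists2 r, (r < N)%N & good r) ->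
  [/\ (ireg s' 6 < N)%N, good (ireg s' 6) &
      cell s' 15 0 0 = (c (ireg s' 6))^-1].
Proof.
move=> <- [r rN gr].
suff H : (exists2 r, (r < ireg s 0 + ireg s 1)%N & good r) ->
   [/\ (ireg s' 6 < ireg s 0 + ireg s 1)%N, good (ireg s' 6) &
      cell s' 15 0 0 = (c (ireg s' 6))^-1] by apply: H; exists r.
rewrite /s'; apply: (for_loop_rule (x := 4%N) (e := nrows) (c := PSeq _ _)
  (P := fun k s' =>
  (exists2 r, (r < k)%N & good r) ->
  [/\ (ireg s' 6 < k)%N, good (ireg s' 6) &
      cell s' 15 0 0 = (c (ireg s' 6))^-1])) => //.
  by case.
move=> {rN gr s' r} k s' kN s'k hr ha inv; rewrite den_seq !denE /= s'k.
rewrite (ha 10%N) // (ha 11%N) // (ha 13%N) // (ha 16%N) // -/(c k).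
rewrite -ltNge -/(good k); case: ifP => gk h.
  by rewrite den_seq !denE /= s'k.
have /inv[i1 i2 i3] : exists2 r, (r < k)%N & good r.
  case: h => r rk gr; exists r => //; rewrite ltn_neqAle -ltnS rk andbT.
  by apply: contraFneq gk => <-.
by split=> //=; apply: ltnW.
Qed.

Section Step.
Variables (m n : nat) (a : 'I_(m + n) -> 'cV[R]_n) (e : R).
Let N := (m + n)%N.
Hypotheses (e0 : 0 < e) (e1 : e <= 4^-1) (n0 : (0 < n)%N) (pM : posdef (gram a)).

Definition consts s := [/\ ireg s 0 = m, ireg s 1 = n, @rows R n N s = a,
  cell s 13 0 0 = e & cell s 13 3 0 = 1 + 4 * e].

Lemma consts_ext s s' : (forall y, (y < 2)%N -> ireg s' y = ireg s y) ->
  cell s' 0 = cell s 0 -> cell s' 13 = cell s 13 -> consts s -> consts s'.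
Proof.
by move=> hr h0 h13 [c0 c1 c2 c3 c4]; split; rewrite ?hr ?h13 // (rows_ext _ _ h0).
Qed.

Lemma row_forms_gram s X d (r : 'I_N) : (0 < X < 6)%N -> (9 < d)%N -> consts s ->
  cell (den (row_forms X d) s) d r 0 = qf (mat n s X) (a r) /\
  cell (den (row_forms X d) s) d r 1 = qf (gram a) (mat n s X *m a r).
Proof.
move=> hX hd [s0 s1 <- _ _].
have [|-> -> _] := row_formsP hX hd s1 (r := r); first by rewrite s0.
by rewrite qf_gram s0.
Qed.

Lemma shiftP s U L (s' := den shift s) (Y := mat n s' 4) (W := mat n s' 5) :
  consts s -> pdinv U (mat n s 4) -> pdinv L (mat n s 5) ->
  gtr a (mat n s 5) < 1 ->
  [/\ consts s', pdinv (U + (1 + 4 * e) *: gram a) Y, pdinv (L - gram a) W,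
      cell s' 16 0 0 = gtr a Y /\ cell s' 16 1 0 = gtr a W &
      forall r : 'I_N,
        [/\ cell s' 10 r 0 = qf Y (a r),
            cell s' 10 r 1 = qf (gram a) (Y *m a r),
            cell s' 11 r 0 = qf W (a r) &
            cell s' 11 r 1 = qf (gram a) (W *m a r)]].
Proof.
move=> cs hU hL tL; have [s0 s1 sa s13 s133] := cs.
have w1 : gram a = wgram a (fun i => (i < N)%N%:R).
  by apply: eq_wgram => i; rewrite ltn_ord.
have := @rank1_loopP _ n N s 4 delta_cell (1 + 4 * e) nrows U isT s1.
rewrite /= s0 s1 => /(_ (leqnn _)) H4.
have {H4} : pdinv (U + (1 + 4 * e) *: gram a)
    (mat n (den (PFor 4 nrows (rank1 4 delta_cell)) s) 4).
  rewrite w1 -sa; apply: H4 => // [s'' ha|k _]; first by rewrite ha.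
  rewrite scale_wgram; apply: posdefD_wgram => [|i]; first exact: hU.1.
  by rewrite mulr_ge0 ?ler0n // addr_ge0 // mulr_ge0 // ltW.
move: (erefl s'); rewrite {1}/s' /shift den_seq; set t1 := den _ s => E1 hY.
have ct1 : consts t1.
  by apply: consts_ext cs => [y y2||]; rewrite ?den_ireg ?den_cell //; side.
have t15 : mat n t1 5 = mat n s 5 by apply: mat_ext; rewrite den_cell //; side.
have [t10 t11 t1a _ _] := ct1; rewrite -t15 in hL tL.
clearbody t1.
have := @rank1_loopP _ n N t1 5 (ROpp (RCst 1)) (-1) nrows L isT t11.
rewrite /= t10 t11 => /(_ (leqnn _)) H5.
have {H5} : pdinv (L - gram a)
    (mat n (den (PFor 4 nrows (rank1 5 (ROpp (RCst 1)))) t1) 5).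
  rewrite w1 -scaleN1r -t1a; apply: H5 => // k _.
  rewrite scaleN1r; apply: posdef_wgram_le => [|i]; last by case: ltnP.
  by rewrite t1a; apply: posdef_shift_down hL tL.
move: E1; rewrite den_seq; set t2 := den _ t1 => E1 hW.
have ct2 : consts t2.
  by apply: consts_ext ct1 => [y y2||]; rewrite ?den_ireg ?den_cell //; side.
have t24 : mat n t2 4 = mat n t1 4 by apply: mat_ext; rewrite den_cell //; side.
rewrite -t24 in hY; clearbody t2; move: E1; rewrite 2!den_seq.
have f10 r := @row_forms_gram t2 4 10 r isT isT ct2.
set t3 := den _ t2 in f10 *.
have ct3 : consts t3.
  by apply: consts_ext ct2 => [y y2||]; rewrite ?den_ireg ?den_cell //; side.
have t34 : mat n t3 4 = mat n t2 4 by apply: mat_ext; rewrite den_cell //; side.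
have t35 : mat n t3 5 = mat n t2 5 by apply: mat_ext; rewrite den_cell //; side.
rewrite -t34 in hY; rewrite -t35 in hW.
have {}f10 (r : 'I_N) : cell t3 10 r 0 = qf (mat n t3 4) (a r) /\
    cell t3 10 r 1 = qf (gram a) (mat n t3 4 *m a r) by rewrite t34.
clearbody t3.
have f11 r := @row_forms_gram t3 5 11 r isT isT ct3.
set t4 := den _ t3 in f11 *.
have ct4 : consts t4.
  by apply: consts_ext ct3 => [y y2||]; rewrite ?den_ireg ?den_cell //; side.
have t44 : mat n t4 4 = mat n t3 4 by apply: mat_ext; rewrite den_cell //; side.
have t45 : mat n t4 5 = mat n t3 5 by apply: mat_ext; rewrite den_cell //; side.
have t410 : cell t4 10 = cell t3 10 by rewrite den_cell //; side.
rewrite -t44 in hY; rewrite -t45 in hW.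
have {}f11 (r : 'I_N) : cell t4 11 r 0 = qf (mat n t4 5) (a r) /\
    cell t4 11 r 1 = qf (gram a) (mat n t4 5 *m a r) by rewrite t45.
have {}f10 (r : 'I_N) : cell t4 10 r 0 = qf (mat n t4 4) (a r) /\
    cell t4 10 r 1 = qf (gram a) (mat n t4 4 *m a r) by rewrite t44 t410.
clearbody t4; rewrite den_seq !den_psum // => E.
have [t40 t41 _ _ _] := ct4.
have s'4 : Y = mat n t4 4 by rewrite /Y -E.
have s'5 : W = mat n t4 5 by rewrite /W -E.
split; rewrite ?s'4 ?s'5 //.
- rewrite -E; apply: consts_ext ct4 => // y y2 /=.
  by have -> : (y == 2)%N = false by lia.
- rewrite -E /= t40 t41; split; apply: eq_bigr => r _ /=.
    exact: (f10 r).1.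
  exact: (f11 r).1.
- by move=> r; rewrite -E /=; case: (f10 r) (f11 r) => -> -> [-> ->].
Qed.

Definition weights s (i : 'I_N) : R := cell s 8 i 0.

Definition bss t s := [/\ consts s, cell s 14 0 0 = t%:R,
  (forall i, 0 <= weights s i) /\ (#|[set i | weights s i != 0%R]| <= t)%N,
  pdinv ((t%:R * (1 + 4 * e) + n%:R / e) *: gram a - wgram a (weights s))
    (mat n s 4) /\ gtr a (mat n s 4) <= e &
  pdinv (wgram a (weights s) - (t%:R - n%:R / e) *: gram a) (mat n s 5) /\
    gtr a (mat n s 5) <= e].

Lemma updateP s (i : 'I_N) t (s' := den update s) :
  consts s -> ireg s 6 = i -> cell s 14 0 0 = t%:R ->
  [/\ consts s', cell s' 14 0 0 = t.+1%:R,
      forall j, weights s' j = weights s j + cell s 15 0 0 *+ (j == i),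
      mat n s' 4 = rank1_update (mat n s 4) (- cell s 15 0 0) (a i) &
      mat n s' 5 = rank1_update (mat n s 5) (cell s 15 0 0) (a i)].
Proof.
move=> cs s6 s14; rewrite /s' /update 4!den_seq !denE /=.
set v := cell s 15 0 0; rewrite s6; set u2 := set_cell _ 8 _ _ _.
have cu2 : consts u2.
  by apply: consts_ext cs => // y y2 /=; have -> : (y == 4)%N = false by lia.
have u2v : cell u2 15 0 0 = v by [].
have u24 : ireg u2 4 = i by [].
have u214 : cell u2 14 0 0 = t%:R by [].
have w2 j : weights u2 j = weights s j + v *+ (j == i).
  rewrite /weights /u2 /= andbT val_eqE; case: eqP => [->|_] //=.
  by rewrite addr0.
have m24 : mat n u2 4 = mat n s 4 by apply: mat_ext.
have m25 : mat n u2 5 = mat n s 5 by apply: mat_ext.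
rewrite -m24 -m25; clearbody u2 v.
have ri s'' : consts s'' -> row_vec n s'' i = a i.
  by case=> _ _ <-.
set u3 := den _ u2.
have cu3 : consts u3.
  by apply: consts_ext cu2 => [y y2||]; rewrite ?den_ireg ?den_cell //; side.
have u34 : ireg u3 4 = i by rewrite den_ireg //; side.
have m34 : mat n u3 4 = rank1_update (mat n u2 4) (- v) (a i).
  by case: cu2 => c20 c21 <- _ _; rewrite rank1P //= u2v u24.
have m35 : mat n u3 5 = mat n u2 5 by apply: mat_ext; rewrite den_cell //; side.
have u3v : cell u3 15 0 0 = v by rewrite den_cell //; side.
have u314 : cell u3 14 0 0 = t%:R by rewrite den_cell //; side.
have u38 : weights u3 =1 weights u2.
  by move=> j; rewrite /weights den_cell //; side.
rewrite -m34 -m35; clearbody u3.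
set u4 := den _ u3.
have cu4 : consts u4.
  by apply: consts_ext cu3 => [y y2||]; rewrite ?den_ireg ?den_cell //; side.
have m45 : mat n u4 5 = rank1_update (mat n u3 5) v (a i).
  by case: cu3 => c20 c21 <- _ _; rewrite rank1P //= u3v u34.
have m44 : mat n u4 4 = mat n u3 4 by apply: mat_ext; rewrite den_cell //; side.
have u414 : cell u4 14 0 0 = t%:R by rewrite den_cell //; side.
have u48 : weights u4 =1 weights u3.
  by move=> j; rewrite /weights den_cell //; side.
rewrite -m44 -m45; clearbody u4.
split; try by [].
- by rewrite /= u414 natr1.
- by move=> j; rewrite -w2 -u38 -u48.
Qed.

Lemma bss_stepP t s : bss t s -> bss t.+1 (den bss_step s).
Proof.
move=> [cs s14 [w0 wt] [hU tU] [hL tL]].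
have tL1 : gtr a (mat n s 5) < 1 by have := e1; lra.
have [cs1 hY hW [tY tW] forms] := shiftP cs hU hL tL1.
have := exists_admissible e0 e1 pM n0 hU tU hL tL hY hW.
have up := admissible_upper (W := mat n (den shift s) 5) e0 pM n0 hU tU hY.
have lo := admissible_lower (Y := mat n (den shift s) 4) (e := e) hW.
rewrite /bss_step 2!den_seq; set s1 := den shift s in cs1 hY hW tY tW forms up lo *.
have s114 : cell s1 14 0 0 = t%:R by rewrite den_cell //; side.
have w1 : weights s1 =1 weights s.
  by move=> j; rewrite /weights den_cell //; side.
clearbody s1 => -[i0 adm0].
have [c10 c11 c1a c1e _] := cs1.
have cE (r : 'I_N) : cell s1 10 r 1 / (cell s1 13 0 0 - cell s1 16 0 0) +
    cell s1 10 r 0 = inv_weight a e (mat n s1 4) r.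
  by case: (forms r) => -> -> _ _; rewrite c1e tY.
have goodE (r : 'I_N) (c := cell s1 10 r 1 / (cell s1 13 0 0 - cell s1 16 0 0) +
    cell s1 10 r 0) :
    (0 < c) && ((cell s1 16 1 0 - cell s1 13 0 0) * (c + cell s1 11 r 0) <=
      cell s1 11 r 1) = admissible a e (mat n s1 4) (mat n s1 5) r.
  by rewrite /c cE /admissible c1e tW; case: (forms r) => _ _ -> ->.
have [|iN] := selectP (s := s1) (N := N) (f_equal2 addn c10 c11).
  by exists (val i0); [exact: ltn_ord|rewrite goodE].
set s2 := den select s1 in iN *.
have -> : ireg s2 6 = Ordinal iN by [].
rewrite goodE cE => adm s215; set i := Ordinal iN in adm s215.
have cs2 : consts s2.
  by apply: consts_ext cs1 => [y y2||]; rewrite ?den_ireg ?den_cell //; side.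
have m4 : mat n s2 4 = mat n s1 4 by apply: mat_ext; rewrite den_cell //; side.
have m5 : mat n s2 5 = mat n s1 5 by apply: mat_ext; rewrite den_cell //; side.
have s214 : cell s2 14 0 0 = t%:R by rewrite den_cell //; side.
have w2 : weights s2 =1 weights s1.
  by move=> j; rewrite /weights den_cell //; side.
have [cs3 s314 w3 m34 m35] := @updateP s2 i t cs2 erefl s214.
set s3 := den update s2 in cs3 s314 w3 m34 m35 *.
have {}w3 j : weights s3 j = weights s j + cell s2 15 0 0 *+ (j == i).
  by rewrite w3 w2 w1.
rewrite m4 in m34; rewrite m5 in m35; rewrite s215 in w3 m34 m35.
clearbody s2 s3; set c := inv_weight _ _ _ _ in s215 w3 m34 m35.
have c0 : 0 < c by case/andP: adm.
have W3 : wgram a (weights s3) =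
    wgram a (weights s) + c^-1 *: (a i *m (a i)^T).
  by rewrite wgram_add1; apply: eq_wgram => j; rewrite w3.
split=> //.
- split=> [j|]; first by rewrite w3 addr_ge0 // mulrn_wge0 // invr_ge0 ltW.
  apply: (@leq_trans #|i |: [set j | weights s j != 0]|).
    apply/subset_leq_card/subsetP => j; rewrite !inE w3.
    by case: (j == i); rewrite //= mulr0n addr0.
  by rewrite cardsU1 -add1n leq_add // leq_b1.
- rewrite m34; have := up i adm; rewrite -/c W3.
  congr (pdinv _ _ /\ _); rewrite -[t.+1%:R]natr1 opprD addrA.
  congr (_ - _); rewrite addrAC -scalerDl; congr (_ *: _ - _); ring.
- rewrite m35; have := lo i adm; rewrite -/c W3.
  congr (pdinv _ _ /\ _); rewrite -[t.+1%:R]natr1 [in RHS]addrAC.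
  congr (_ + _); rewrite -addrA -opprD; congr (_ - _).
  rewrite -[X in _ + X]scale1r -scalerDl; congr (_ *: _); ring.
Qed.

End Step.
End Correctness.

(** * The main loop and the output of the weights *)

Definition finished : test :=
  TLeR dim_cell (RMul time_cell (RMul eps_cell eps_cell)).

(** Loop bounds cannot mention eps, so the loop has m rounds and idles once the test succeeds. *)
Definition bss_loop : prog := PFor 5 r_m (PIf finished PSkip bss_step).

Definition newton_step : prog :=
  PSetR 2 (IReg 4) C0
    (RDiv (RAdd (RCell 2 (IReg 4) C0) (RDiv (scal 9) (RCell 2 (IReg 4) C0)))
       (RCst 2)).

Definition newton_iters := IAdd (IAdd nrows nrows) (ICst 1).

Definition round_rows : prog :=
  PFor 4 r_m
   (PIf (TLeR (RCell 8 (IReg 4) C0) (RCst 0)) PSkip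
     (set_scal 9 (RDiv (RCell 8 (IReg 4) C0) time_cell) ;;
      PSetR 2 (IReg 4) C0 (RDiv twoN_cell (RCell 12 (IReg 4) (ICst 2))) ;;
      PFor 5 newton_iters newton_step)).

Definition identity_weights : prog :=
  PFor 4 r_m (PSetR 2 (IReg 4) C0 (RCst 1)).

Definition sparsify : prog :=
  prepare ;; setup ;; bss_loop ;;
  PIf finished (row_forms 3 12 ;; round_rows) identity_weights.

Section Correctness.
Variable R : realType.
Implicit Types s : state R.

(** With zero weights and barriers n/e and -n/e, both inverses are (e/n) M^-1, whose potential is e
    by [gtr_inv]. *)
Lemma setupP m n (n0 : (0 < n)%N) s (a : 'I_(m + n) -> 'cV[R]_n)
    (e := cell s 1 0 0 / 4) (s' := den setup s) :
  0 < e -> ireg s 0 = m -> ireg s 1 = n -> @rows R n (m + n) s = a ->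
  pdinv (gram a) (mat n s 3) ->
  (forall i, cell s 8 i 0 = 0) -> cell s 14 0 0 = 0 ->
  [/\ bss a e 0 s', cell s' 13 1 0 = n%:R, cell s' 13 2 0 = 2 * (m + n)%:R &
      mat n s' 3 = mat n s 3].
Proof.
move=> e0 s0 s1 sa hX w0 t0; rewrite /s' /setup 5!den_seq !den_psum // !denE.
set s2 := set_cell _ 13 _ _ (reval _ (RAdd _ _)).
have c2 : consts a e s2.
  by split; [exact: s0|exact: s1|exact: sa| |].
have h1 : cell s2 13 1 0 = n%:R.
  by rewrite /s2 /= s1 sumr_const card_ord.
have h2 : cell s2 13 2 0 = 2 * (m + n)%:R.
  by rewrite /s2 /= s0 s1 sumr_const card_ord mulr_natr.
have h3 : mat n s2 3 = mat n s 3 by apply: mat_ext.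
have h8 : cell s2 8 = cell s 8 by [].
have h14 : cell s2 14 = cell s 14 by [].
rewrite -h3 in hX *; rewrite -h8 in w0; rewrite -h14 in t0.
clearbody s2; set s3 := den _ s2.
have map s'' X : (3 < X < 13)%N -> consts a e s'' -> cell s'' 13 1 0 = n%:R ->
    let s4 := den (PFor 2 r_n (PFor 3 r_n (PSetR X (IReg 2) (IReg 3)
      (RMul (RDiv eps_cell dim_cell) (RCell 3 (IReg 2) (IReg 3)))))) s'' in
    consts a e s4 /\ mat n s4 X = (e / n%:R) *: mat n s'' 3.
  move=> hX' c'' d''; split.
    by apply: consts_ext c'' => [y y2||]; rewrite ?den_ireg ?den_cell //; side.
  have [i0 i1 _ ee _] := c''.
  apply/matrixP => i j; rewrite !mxE.
  apply: (den_map2 (f := fun i j => e / n%:R * cell s'' 3 i j)) => //=;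
    rewrite ?i1 //.
  move=> t i' j' ti tj hr ha _.
  by rewrite (ha 13%N) ?(ha 3%N) ?inE ?ee ?d'' ?ti ?tj //; lia.
have [c3 m3] := map s2 4%N isT c2 h1; rewrite -/s3 in c3 m3.
have d3 : cell s3 13 = cell s2 13 by rewrite den_cell.
have [] := map s3 5%N isT c3; rewrite ?d3 //.
set s4 := den _ s3 => c4 m4.
have m33 : mat n s3 3 = mat n s2 3 by apply: mat_ext; rewrite den_cell.
have m43 : mat n s4 3 = mat n s3 3 by apply: mat_ext; rewrite den_cell.
have m44 : mat n s4 4 = mat n s3 4 by apply: mat_ext; rewrite den_cell.
have nn : 0 < n%:R :> R by rewrite ltr0n.
have W : wgram a (weights s4) = 0.
  rewrite /wgram big1 // => i _; rewrite /weights !den_cell // w0; exact: scale0r.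
have Xs : pdinv ((n%:R / e) *: gram a) ((e / n%:R) *: mat n s2 3).
  by rewrite -[e / _]invf_div; apply: pdinvZ => //; rewrite divr_gt0.
have ts : gtr a ((e / n%:R) *: mat n s2 3) <= e.
  by rewrite gtrZ (gtr_inv hX) divfK ?gt_eqF.
split.
- split.
  + exact: c4.
  + by rewrite !den_cell.
  + split=> [i|]; first by rewrite /weights !den_cell // w0.
    rewrite leqn0 cards_eq0; apply/eqP/setP => i.
    by rewrite !inE /weights !den_cell // w0 eqxx.
  + by rewrite W subr0 mul0r add0r m44 m3.
  + by rewrite W sub0r sub0r scaleNr opprK m4 m33.
- by rewrite !den_cell.
- by rewrite !den_cell.
- by rewrite m43 m33.
Qed.

Section Loop.
Variables (m n : nat) (a : 'I_(m + n) -> 'cV[R]_n) (e : R).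
Hypotheses (e0 : 0 < e) (e1 : e <= 4^-1) (n0 : (0 < n)%N) (pM : posdef (gram a)).

Lemma bss_set_ireg t s y v :
  (1 < y)%N -> bss a e t s -> bss a e t (set_ireg s y v).
Proof.
move=> y1 [[c0 c1 c2 c3 c4] h14 h8 h4 h5]; split=> //; split=> //=.
  by have -> : (0 == y)%N = false by lia.
by have -> : (1 == y)%N = false by lia.
Qed.

Lemma finishedE s t : bss a e t s -> cell s 13 1 0 = n%:R ->
  teval s finished = (n%:R <= t%:R * e ^+ 2).
Proof. by case=> -[_ _ _ ee _] tt _ _ _ dd; rewrite /= ee tt dd expr2. Qed.

(** A step is made only while t e^2 < n, whence the upper bound on t. *)
Lemma bss_loopP s (s' := den bss_loop s) :
  bss a e 0 s -> cell s 13 1 0 = n%:R ->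
  exists t, [/\ bss a e t s', t%:R * e ^+ 2 < n%:R + e ^+ 2, (t <= m)%N &
    n%:R <= t%:R * e ^+ 2 \/ t = m].
Proof.
move=> b0 d0; have [[s0 _ _ _ _] _ _ _ _] := b0.
rewrite /s' /bss_loop.
suff : exists t, [/\ bss a e t (den bss_loop s), t%:R * e ^+ 2 < n%:R + e ^+ 2,
    (t <= ieval s r_m)%N & n%:R <= t%:R * e ^+ 2 \/ t = ieval s r_m] by rewrite /= s0.
apply: (for_loop_rule (x := 5%N) (e := r_m) (P := fun k s' =>
  exists t, [/\ bss a e t s', t%:R * e ^+ 2 < n%:R + e ^+ 2,
    (t <= k)%N & n%:R <= t%:R * e ^+ 2 \/ t = k])).
- rewrite /bss_step /shift /select /update /= !frameE; side.
- exists 0; split=> //; last by right.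
  by rewrite mul0r addr_gt0 ?ltr0n ?exprn_gt0.
move=> k s1 ks s1k hr ha [t [bt tn tk h]].
have d1 : cell s1 13 1 0 = n%:R by rewrite ha.
rewrite denE (finishedE bt d1); case: lerP => hn.
  by exists t; split=> //; [exact: leqW|left].
have -> : k = t by case: h => // h; move: hn; rewrite ltNge h.
exists t.+1; split; last by right.
- by apply: bss_set_ireg => //; apply: bss_stepP.
- by rewrite -natr1 mulrDl mul1r ltrD2r.
- exact: leqnn.
Qed.

End Loop.

Lemma iter_newtonE s (i : nat) t e : ireg s 4 = i ->
  cell (den (PFor 5 e newton_step) s) 2 i 0 =
    iter (ieval s e) (newton (cell s 6 9 0)) (cell s 2 i 0) /\
  (forall j, j != i -> cell (den (PFor 5 e newton_step) s) 2 j t = cell s 2 j t).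
Proof.
move=> s4; apply: (for_loop_rule (x := 5%N) (P := fun k s' =>
  cell s' 2 i 0 = iter k (newton (cell s 6 9 0)) (cell s 2 i 0) /\
  (forall j, j != i -> cell s' 2 j t = cell s 2 j t))) => //.
move=> k s' ks s'k hr ha [h1 h2]; rewrite /newton_step denE /= hr // s4.
rewrite !eqxx /= h1 (ha 6%N) //; split=> // j ji.
by rewrite (negbTE ji) /= h2.
Qed.

Lemma round_rowsP m n s (i : nat) (s' := den round_rows s) :
  ireg s 0 = m -> ireg s 1 = n -> (i < m)%N -> (forall i, cell s 2 i 0 = 0) ->
  cell s' 2 i 0 = if cell s 8 i 0 <= 0 then 0 else
    iter (m + n + (m + n) + 1) (newton (cell s 8 i 0 / cell s 14 0 0))
      (cell s 13 2 0 / cell s 12 i 2).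
Proof.
move=> s0 s1 im z.
suff H : forall i, cell s' 2 i 0 = if (i < ieval s r_m)%N then
    if cell s 8 i 0 <= 0 then 0 else
    iter (m + n + (m + n) + 1) (newton (cell s 8 i 0 / cell s 14 0 0))
      (cell s 13 2 0 / cell s 12 i 2) else 0.
  by rewrite H /= s0 im.
rewrite /s'; apply: (for_loop_rule (x := 4%N) (c := PIf _ _ _) (P := fun k s' =>
  forall i, cell s' 2 i 0 = if (i < k)%N then
    if cell s 8 i 0 <= 0 then 0 else
    iter (m + n + (m + n) + 1) (newton (cell s 8 i 0 / cell s 14 0 0))
      (cell s 13 2 0 / cell s 12 i 2) else 0)) => //.
move=> {i im} k t ks tk hr ha inv i.
rewrite denE [teval _ _]/= (ha 8%N) // tk; case: ifP => wk.
  rewrite /= inv [in RHS]ltnS [in RHS]leq_eqVlt.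
  by case: eqP => [->|_] //=; rewrite ltnn wk.
rewrite 2!den_seq !denE /= tk.
set u := set_cell _ 2 _ _ _.
have u4 : ireg u 4 = k by [].
have u0 : ireg u 0 = m by rewrite /u /= hr.
have u1 : ireg u 1 = n by rewrite /u /= hr.
have u9 : cell u 6 9 0 = cell s 8 k 0 / cell s 14 0 0.
  by rewrite /u /= (ha 8%N) // (ha 14%N).
have u2 : cell u 2 k 0 = cell s 13 2 0 / cell s 12 k 2.
  by rewrite /u /= eqxx (ha 13%N) // (ha 12%N).
have u2' j : j != k -> cell u 2 j 0 = cell t 2 j 0.
  by move=> jk; rewrite /u /= (negbTE jk).
clearbody u; have [e1 e2] := @iter_newtonE u k 0 newton_iters u4.
have [->|ik] := eqVneq i k.
  by rewrite e1 ltnSn wk u9 u2 /= u0 u1.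
by rewrite e2 // u2' // inv [in RHS]ltnS [in RHS]leq_eqVlt (negbTE ik).
Qed.

Lemma identity_weightsP s (i : nat) : (i < ireg s 0)%N ->
  cell (den identity_weights s) 2 i 0 = 1.
Proof.
move=> im; suff H : forall i, (i < ieval s r_m)%N ->
  cell (den identity_weights s) 2 i 0 = 1 by exact: H.
apply: (for_loop_rule (x := 4%N) (c := PSetR _ _ _ _)
  (P := fun k s' => forall i, (i < k)%N -> cell s' 2 i 0 = 1)) => //.
move=> {i im} k t ks tk hr ha inv i; rewrite denE /= tk ltnS leq_eqVlt.
by case: eqP => //= _; apply: inv.
Qed.

End Correctness.

Lemma wf_sparsify : wf sparsify.
Proof. by vm_compute. Qed.

(** Reduces to N^4 <= (2^N)^4. Together with 1 <= N e it shows that 2N + 1 Newton iterations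
    suffice. *)
Lemma newton_iters_bound (N : nat) : (N * (4 * N ^ 2) * N <= 4 ^ (N + N + 1))%N.
Proof.
have -> : (N * (4 * N ^ 2) * N = N ^ 4 * 4)%N by ring.
rewrite expnD leq_mul2r /= -{2}[4%N]/(2 ^ 2)%N -expnM.
have -> : (2 * (N + N) = N * 4)%N by ring.
by rewrite expnM leq_exp2r // ltnW // ltn_expl.
Qed.

(** * Guarantees of the whole program *)

Section Sparsify.
Variables (R : realType) (m n : nat) (A : 'M[R]_(m, n)) (eps : R).
Hypotheses (m0 : (0 < m)%N) (n0 : (0 < n)%N) (eps0 : 0 < eps) (eps1 : eps <= 1).

Definition diag_entry (i : 'I_m) : R :=
  cell (den sparsify (init_state A eps)) 2 i 0.

Ltac frame := by vm_compute.

(** The constant is 16 + 1: t e^2 < n + e^2 with e = eps/4 gives t < 16 n/eps^2 + 1, and 1 <=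
    n/eps^2. *)
Lemma sparsifyP : [/\ forall i, 0 <= diag_entry i,
  #|[set i | diag_entry i != 0]|%:R <= 17 * (n%:R / eps ^+ 2) &
  forall x : 'cV[R]_n, (1 - eps / 4) * (\sum_i (A *m x) i 0 ^+ 2) <=
      \sum_i diag_entry i ^+ 2 * (A *m x) i 0 ^+ 2 /\
    \sum_i diag_entry i ^+ 2 * (A *m x) i 0 ^+ 2 <=
      (1 + 6 * (eps / 4)) * (\sum_i (A *m x) i 0 ^+ 2)].
Proof.
have eps_le1 := eps1; have eps_gt0 := eps0.
rewrite /diag_entry; set s0 := init_state A eps; pose s1 := den prepare s0.
pose s2 := den setup s1; pose s3 := den bss_loop s2.
have [hX rowA proj] := prepareP A eps; rewrite -/s1 in hX rowA proj.
set a := @rows R n (m + n) s1 in hX.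
have i10 : ireg s1 0 = m by rewrite den_ireg; last frame.
have i11 : ireg s1 1 = n by rewrite den_ireg; last frame.
have c1 : cell s1 1 0 0 = eps by rewrite den_cell; last frame.
have c2 i : cell s1 2 i 0 = 0 by rewrite den_cell; last frame.
set e := eps / 4; have e0 : 0 < e by rewrite divr_gt0.
have e1 : e <= 4^-1 by have := eps1; rewrite /e; lra.
have [|||b2 d2 nn2 m2] := @setupP R m n n0 s1 a _ i10 i11 erefl hX.
- by rewrite c1.
- by move=> i; rewrite den_cell; last frame.
- by rewrite den_cell; last frame.
rewrite -/s2 c1 -/e in b2 d2 nn2 m2.
have [t [b3 tn tm fin]] := bss_loopP e0 e1 n0 hX.1 b2 d2.
rewrite -/s3 in b3.
have d3 : cell s3 13 = cell s2 13 by rewrite den_cell; last frame.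
have m3 : mat n s3 3 = mat n s1 3.
  by rewrite -m2; apply: mat_ext; rewrite den_cell; last frame.
have c3 i : cell s3 2 i 0 = 0.
  by rewrite den_cell; [rewrite den_cell; [exact: c2|frame]|frame].
have [[i30 i31 a3 _ _] t3 [w0 wt] [[pU _] _] [[pL _] _]] := b3.
have finE : teval s3 finished = (n%:R <= t%:R * e ^+ 2).
  by apply: (finishedE b3); rewrite d3.
have -> : den sparsify s0 = if n%:R <= t%:R * e ^+ 2 then
    den round_rows (den (row_forms 3 12) s3) else den identity_weights s3.
  by rewrite -finE.
clearbody s1 s2 s3; move: hX rowA proj; rewrite -m3 => hX rowA proj.
have n1 : 1 <= n%:R :> R by rewrite ler1n.
have eps2 : 0 < eps ^+ 2 by rewrite exprn_gt0.
have eps21 : eps ^+ 2 <= 1 by rewrite expr_le1 // ltW.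
have e2 : e ^+ 2 = eps ^+ 2 / 16 by rewrite /e; field.
have Adot x (i : 'I_m) : (A *m x) i 0 = dot (a (lshift n i)) x.
  by rewrite /a /rows /= rowA !mxE; apply: eq_bigr => j _; rewrite !mxE.
case: ifP => [nt|/negbT]; last first.
  (* All m rounds were used without reaching n/e^2, so m < 16 n/eps^2 and D = I is sparse enough. *)
  rewrite -ltNge => nt; case: fin => [nt'|tE]; first by rewrite ltNge nt' in nt.
  have d1 (i : 'I_m) : cell (den identity_weights s3) 2 i 0 = 1.
    by rewrite identity_weightsP ?i30.
  split.
  - by move=> i; rewrite d1.
  - apply: (@le_trans _ _ m%:R).
      by rewrite ler_nat (leq_trans (max_card _)) // card_ord.
    rewrite mulrA ler_pdivlMr //; rewrite tE e2 in nt; lra.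
  - move=> x; set S := \sum_i (A *m x) i 0 ^+ 2.
    rewrite (_ : \sum_i _ = S); last first.
      by apply: eq_bigr => i _; rewrite d1 expr1n mul1r.
    have S0 : 0 <= S by apply: sumr_ge0 => i _; apply: sqr_ge0.
    have : 0 <= e * S by rewrite mulr_ge0 // ltW.
    by split; lra.
set N := (m + n)%N; have N0 : (0 < N)%N by rewrite addn_gt0 m0.
have t0 : 0 < t%:R :> R.
  rewrite ltr0n lt0n; apply: contraTneq nt => ->; rewrite mul0r -ltNge.
  by rewrite ltr0n.
(* As n <= t e^2 and t <= N, a very small eps cannot occur here; hence the number of Newton
   iterations depends on N only. *)
have Ne : 1 <= N%:R * e.
  have : t%:R <= N%:R :> R by rewrite ler_nat (leq_trans tm) // leq_addr.
  move=> tN; apply: le_trans n1 _; apply: le_trans nt _.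
  rewrite expr2 mulrA; apply: (@le_trans _ _ (t%:R * e * 1)).
    by rewrite ler_pM2l ?mulr_gt0 //; lra.
  by rewrite mulr1 ler_wpM2r // ltW.
pose K := (N + N + 1)%N.
have hK : #|'I_N|%:R * (4 * #|'I_N|%:R ^+ 2) <= e * 4 ^+ K.
  rewrite card_ord -(ler_pM2l (_ : 0 < N%:R :> R)) ?ltr0n //.
  apply: (@le_trans _ _ (4 ^+ K)).
    by rewrite -[4]/(4%:R) -!natrX -!natrM ler_nat mulnC newton_iters_bound.
  by rewrite mulrA ler_peMl // exprn_ge0.
have [s4 -> fE] : exists2 s4, s4 = den (row_forms 3 12) s3 &
    forall i : 'I_m, cell s4 12 i 2 =
      \sum_j `|dot (a j) (mat n s3 3 *m a (lshift n i))|.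
  exists (den (row_forms 3 12) s3) => // i.
  have [|_ _ ->] := @row_formsP R n s3 3 12 i isT isT i31.
    by rewrite i30 (leq_trans (ltn_ord i)) // leq_addr.
  by rewrite i30 -a3.
pose d := rounded a (weights s3) (mat n s3 3) t%:R K.
have dE (i : 'I_m) :
    cell (den round_rows (den (row_forms 3 12) s3)) 2 i 0 = d (lshift n i).
  rewrite (@round_rowsP R m n) ?den_ireg ?frameE // => [|j]; last first.
    by rewrite den_cell ?frameE.
  rewrite /d /rounded -fE !(den_cell _ (a := 8)) ?frameE //.
  rewrite !(den_cell _ (a := 13)) ?frameE // !(den_cell _ (a := 14)) ?frameE //.
  by rewrite d3 nn2 t3 card_ord.
split.
- by move=> i; rewrite dE; apply: rounded_ge0.
- apply: (@le_trans _ _ t%:R).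
    rewrite ler_nat (leq_trans _ wt) // -(card_imset _ (@lshift_inj m n)).
    apply/subset_leq_card/subsetP => j /imsetP[i]; rewrite !inE dE => di ->.
    by apply: contraNneq di => wi; rewrite /d /rounded wi lexx.
  by rewrite mulrA ler_pdivlMr //; rewrite e2 in tn; lra.
(* At [x'] the added rows vanish and the rows of A act as at [x], so the bounds for all rows become
   bounds for A. *)
- move=> x; have [x' [x'0 x'1]] := proj x.
  have E (f : 'I_N -> R) : \sum_i f i * dot (a i) x' ^+ 2 =
      \sum_i f (lshift n i) * (A *m x) i 0 ^+ 2.
    rewrite big_split_ord /= [X in _ + X]big1 ?addr0 => [|i _].
      by apply: eq_bigr => i _; rewrite Adot -[dot (a _) x]x'1 /=.
    by rewrite [dot _ _]x'0 ?expr0n ?mulr0 //= leq_addr.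
  have := roundedP e0 e1 t0 nt hX w0 pU pL hK x'.
  rewrite qf_wgram !E; under eq_bigr do rewrite mul1r.
  rewrite -/d; under [X in _ <= X /\ _]eq_bigr do rewrite -dE.
  by under [X in _ /\ X <= _]eq_bigr do rewrite -dE.
Qed.
End Sparsify.

Theorem theorem4 (R : realType) :
  exists C : R, 0 < C /\
  exists (P : cmd) (p : {poly nat}),
  forall (m n : nat) (A : 'M[R]_(m, n)) (eps : R),
    (0 < m)%N -> (0 < n)%N -> 0 < eps -> eps <= 1 ->
  exists D : 'M[R]_m,
    [/\ is_diag_mx D,
        forall i j, 0 <= D i j,
        (nb_nonzero D)%:R <= C * (n%:R / eps ^+ 2),
        forall x : 'cV[R]_n,
          (1 - eps) * norm2 (A *m x) <= norm2 (D *m A *m x)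
          /\ norm2 (D *m A *m x) <= (1 + eps) * norm2 (A *m x)
      & computes_diag P A eps D p.[(m * n).+1]].
Proof.
exists 17; split=> //; exists (compile sparsify), (cost sparsify).
move=> m n A eps m0 n0 eps0 eps1.
have [d0 dn dx] := sparsifyP A m0 n0 eps0 eps1.
pose d := diag_entry A eps; pose D := diag_mx (\row_i d i).
exists D; split.
- exact: diag_mx_is_diag.
- by move=> i j; rewrite !mxE; case: eqP => _; rewrite ?mulr1n ?mulr0n.
- apply: le_trans dn; rewrite ler_nat.
  rewrite -(card_imset [set i | d i != 0] (f := fun i => (i, i)));
    last by move=> i j [].
  apply/subset_leq_card/subsetP => -[i j]; rewrite inE /= !mxE.
  have [<-|ij] := eqVneq i j; last by rewrite mulr0n eqxx.
  by rewrite mulr1n => di; apply/imsetP; exists i; rewrite ?inE.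
- move=> x; have [lo hi] := dx x; rewrite /norm2 -mulmxA.
  set P := \sum_i (A *m x) i 0 ^+ 2 in lo hi *.
  rewrite (_ : \sum_i (D *m (A *m x)) i 0 ^+ 2 =
    \sum_i d i ^+ 2 * (A *m x) i 0 ^+ 2); last first.
    by apply: eq_bigr => i _; rewrite mul_diag_mx !mxE exprMn.
  set Q := \sum_i d i ^+ 2 * _ in lo hi *.
  have P0 : 0 <= P by apply: sumr_ge0 => i _; apply: sqr_ge0.
  (* It remains to compare squares: (1 - eps)^2 <= 1 - eps/4 and 1 + 3 eps/2 <= (1 + eps)^2. *)
  have ee : 0 <= eps * (1 - eps) by rewrite mulr_ge0 ?subr_ge0 // ltW.
  rewrite -[1 - eps]ger0_norm ?subr_ge0 // -[1 + eps]ger0_norm; last by lra.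
  rewrite -!sqrtr_sqr -!sqrtrM ?sqr_ge0 //; split; apply: ler_wsqrtr.
    apply: le_trans lo; rewrite ler_wpM2r // expr2; lra.
  by apply: le_trans hi _; rewrite ler_wpM2r // expr2; nra.
(* Both dimensions are positive, so m n + 1 bounds each of them. *)
have mn : (m <= (m * n).+1)%N by nia.
have nm : (n <= (m * n).+1)%N by nia.
have [|t et tt] :=
  @exec_compile R sparsify (init_state A eps) (m * n).+1 wf_sparsify.
  by case=> [|[|]].
exists t, (den sparsify (init_state A eps)); split=> // i.
by rewrite !mxE eqxx mulr1n.
Qed.
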